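(* For every $\varepsilon>0$ there exists a constant $C_\varepsilon>0$ depending only on $\varepsilon$ such that for every dimension $d\in\mathbb{N}$, every $p\in[2,\infty]$ and every $f\in\ell^p(\mathbb{Z}^d)$, $$\Big\|\sup_{0\le t\le d^{\frac12-\varepsilon}}|\mathcal{M}_t f|\Big\|_{\ell^p(\mathbb{Z}^d)}\le C_\varepsilon\|f\|_{\ell^p(\mathbb{Z}^d)} .$$
   Context: $\mathbb{N}=\{1,2,\dots\}$. For real $t\ge0$ let $tB=\{y\in\mathbb{Z}^d:\sum_{j=1}^d y_j^2\le t^2\}$ be the set of lattice points in the closed Euclidean ball of radius $t$, with $|tB|$ elements. The averaging operator is $\mathcal{M}_tf(x)=\frac{1}{|tB|}\sum_{y\in tB}f(x-y)$ for $x\in\mathbb{Z}^d$. *)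

(* Defs.v *)
From HB Require Import structures.
From mathcomp Require Import all_boot all_order all_algebra finmap.
From mathcomp Require Import complex zify.
From mathcomp Require Import all_classical all_reals all_analysis.

Set Implicit Arguments.
Unset Strict Implicit.
Unset Printing Implicit Defensive.
Import Order.TTheory GRing.Theory Num.Theory.

Local Open Scope classical_set_scope.
Local Open Scope ring_scope.

(* An alias of 'rV[int]_d, so that it can carry the discrete sigma-algebra. *)
Definition lattice (d : nat) : Type := 'rV[int]_d.

HB.instance Definition _ (d : nat) := GRing.Zmodule.on (lattice d).
HB.instance Definition _ (d : nat) := isPointed.Build (lattice d) 0.
HB.instance Definition _ (d : nat) :=
  @isMeasurable.Build default_measure_display (lattice d)
    (@discrete_measurable (lattice d)) (@discrete_measurable0 (lattice d))
    (@discrete_measurableC (lattice d)) (@discrete_measurableU (lattice d)).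

Definition lattice_ball (R : realType) (d : nat) (t : R) : set (lattice d) :=
  [set y : lattice d | \sum_(j < d) ((y ord0 j)%:~R : R) ^+ 2 <= t ^+ 2].

Arguments lattice_ball {R} d t.

(* fset_set and sums over a set default to trivial values on infinite sets;
   this lemma shows that the default case never occurs in avg. *)
Lemma finite_lattice_ball (R : realType) (d : nat) (t : R) :
  finite_set (lattice_ball d t).
Proof.
pose N := (Num.truncn `|t|).+1.
have tN : `|t| < N%:R.
  by rewrite /N truncnS_gt.
pose g (k : {ffun 'I_d -> 'I_(N.*2)}) : lattice d :=
  \row_j ((k j)%:Z - N%:Z).
apply: (@sub_finite_set _ _ (g @` setT)); last first.
  exact/finite_image/finite_finset.
move=> y /= yt.
have yN j : `|y ord0 j| < N%:Z.
  rewrite -(ltr_int R) intr_norm; apply: le_lt_trans tN.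
  rewrite -(@ler_sqr R) ?nnegrE// !real_normK ?num_real//.
  apply: le_trans yt; rewrite (bigD1 j)//= lerDl.
  by apply: sumr_ge0 => i _; rewrite sqr_ge0.
have kN j : (`|(y ord0 j + N%:Z)%R|%N < N.*2)%N.
  have := yN j; rewrite -addnn ltr_norml; move: (y ord0 j) => k /andP[].
  by lia.
exists [ffun j => Ordinal (kN j)] => //.
apply/rowP => j; rewrite mxE ffunE /=.
have := yN j; rewrite ltr_norml; move: (y ord0 j) => k /andP[].
by lia.
Qed.

Definition avg (R : realType) (d : nat) (t : R) (f : lattice d -> R[i])
    (x : lattice d) : R[i] :=
  (#|` fset_set (lattice_ball d t)|%:R)^-1 *
    \sum_(y \in lattice_ball d t) f (x - y).

(* ComplexField.Normc.normc is the R-valued modulus; `|z| would be R[i]-valued. *)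
Definition max_avg (R : realType) (d : nat) (T : R) (f : lattice d -> R[i])
    (x : lattice d) : \bar R :=
  ereal_sup [set (ComplexField.Normc.normc (avg t f x))%:E |
              t in [set t : R | 0 <= t <= T]].

Definition lp_norm (R : realType) (d : nat) (p : \bar R) (g : lattice d -> \bar R)
    : \bar R :=
  Lnorm (@counting (lattice d) R) p g.

Definition lp_normc (R : realType) (d : nat) (p : \bar R) (f : lattice d -> R[i])
    : \bar R :=
  lp_norm p (fun x => (ComplexField.Normc.normc (f x))%:E).

(* Every function on the lattice is measurable (discrete sigma-algebra), so that
   membership in l^p only requires the norm to be finite. *)
Definition in_lp (R : realType) (d : nat) (p : \bar R) (f : lattice d -> R[i])
    : Prop :=
  (lp_normc p f < +oo)%E.

(* Main.v *)
Require Import Defs.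
From mathcomp Require Import all_boot all_order all_algebra perm fingroup finmap.
From mathcomp Require Import complex.
From mathcomp Require Import all_classical all_reals all_analysis.
From mathcomp Require Import ess_sup_inf.
From mathcomp Require Import ring lra zify.

(** The averages have nonnegative weights, so Jensen's inequality bounds the
    (p/2)-th power of the average of |f| by the average of |f|^(p/2); the case
    p = 2 applied to |f|^(p/2) then gives every finite p >= 2 with the same
    constant, and p = oo is immediate.  For p = 2 it is enough to find, for each
    u >= 0, one function V that majorises all averages of u over the balls of
    squared radius at most N = floor(d^(1 - 2 eps)), with the l^2 norm of V at
    most a constant times that of u ([l2_max]).

    Points with small coordinates carry almost everything.  Fix m with
    2 eps m >= 3.  Zeroing a coordinate larger than m decreases the squared norm
    by (m+1)^2, and the ball of squared radius n - i holds at most a proportion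
    (2N/d)^i of the ball of squared radius n; hence the proportions of the points
    having such a coordinate have a bounded sum over all n <= N
    ([bad_share_sum]), and this part of the averages is estimated by summation
    over n.  The rest of a ball is a union of orbits of signed permutations, so
    it suffices to majorise the averages over single orbits.  An orbit is
    determined by the numbers a_i of coordinates of absolute value i, for
    1 <= i <= m.

    Orbit averages reduce to the hypercube.  Colour the coordinates with the m
    steps 1, ..., m in equal proportions.  The orbit average at x is the mean,
    over all permutations and signs, of the average over the sets K having a_i
    elements of colour i of u at the point obtained from x by moving each
    coordinate of K by plus or minus its step.  The sign of a move may be chosen
    according to the parity of the block of Z that contains the coordinate, and
    then the moves are commuting involutions ([toggle], [slices_orbsum]).  For a
    fixed permutation and fixed signs, the problem therefore splits over orbits
    of (Z/2)^d, and on each of them one has to bound a maximal function of the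
    hypercube.  The average over K is a composition of averages over slices, one
    for each colour class, so that a one-colour maximal inequality, iterated m
    times, is enough ([slice_max], [slices_max_l2]).

    One colour: let S_k be the average over the k-subsets of an n-set B acting by
    symmetric difference.  Walsh functions diagonalise S_k, and the multipliers
    are normalised Krawtchouk numbers [kraw].  With x the number of minus signs,
    x <= n/2 and k at most a small multiple of n, they decay like
    exp(- k x / (4 n)) ([kraw_decay]), and their increments of step two carry a
    further factor x / n ([kraw_sub2_le]).  For x > n/2 they have the same modulus
    as for n - x and alternate in sign with k; this is the reason for steps of
    two.  The operators S_k are compared with the noise operators that
    re-randomise each coordinate of B with probability k/n, plus their twist by
    the parity of the set: for random labels of the coordinates, noise is a mean
    of reversed martingales, hence has a bounded maximal function by Doob's
    inequality ([doob_chain], [symnoise_max]).  Summation by parts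
    ([abel_sqr_le]) and the two square functions [kraw_diff_sum] and
    [kraw_symnoise_sum] complete the comparison. *)

Set Implicit Arguments.
Unset Strict Implicit.
Unset Printing Implicit Defensive.
Import Order.TTheory GRing.Theory Num.Theory.
Local Open Scope ring_scope.

(** * Krawtchouk numbers *)

Section Kraw.
Variable R : realType.
Implicit Types (k x y m n : nat).

Definition kpoly x y : {poly R} := (1 - 'X) ^+ x * (1 + 'X) ^+ y.

(** Normalised Krawtchouk number: the mean of (-1)^|K :&: X| over the k-subsets
    K of a set of x + y points, where X has x points. *)
Definition kraw k x y : R := (kpoly x y)`_k / 'C(x + y, k)%:R.

Lemma kpoly_deriv x y : (kpoly x y)^`() = - (kpoly x.-1 y) *+ x + (kpoly x y.-1) *+ y.
Proof.
rewrite /kpoly derivM !deriv_exp derivB derivD derivC derivX sub0r add0r.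
by ring.
Qed.

(** Euler's identity for the homogeneous form (w - z)^x (w + z)^y, read at
    w = 1: the left-hand side is its derivative in w. *)
Lemma kpoly_euler x y : kpoly x y *+ (x + y) - 'X * (kpoly x y)^`() =
  kpoly x.-1 y *+ x + kpoly x y.-1 *+ y.
Proof.
rewrite kpoly_deriv.
have Ex : kpoly x y *+ x = ((1 - 'X) * kpoly x.-1 y) *+ x.
  by case: x => [|x]; rewrite ?mulr0n// /kpoly mulrA -exprS.
have Ey : kpoly x y *+ y = ((1 + 'X) * kpoly x y.-1) *+ y.
  by case: y {Ex} => [|y]; rewrite ?mulr0n// /kpoly mulrCA -exprS.
by rewrite mulrnDr Ex Ey; ring.
Qed.

Lemma kcoef_next k x y : (kpoly x y)`_k.+1 * k.+1%:R =
  - (x%:R * (kpoly x.-1 y)`_k) + y%:R * (kpoly x y.-1)`_k.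
Proof.
have := congr1 (fun p : {poly R} => p`_k) (kpoly_deriv x y).
by rewrite /= coef_deriv coefD !coefMn coefN mulr_natr mulNrn !mulr_natl.
Qed.

Lemma kcoef_same k x y : (kpoly x y)`_k * ((x + y)%:R - k%:R) =
  (x%:R * (kpoly x.-1 y)`_k) + y%:R * (kpoly x y.-1)`_k.
Proof.
have := congr1 (fun p : {poly R} => p`_k) (kpoly_euler x y).
rewrite /= coefB coefXM coefD !coefMn coef_deriv !mulr_natl => <-.
rewrite mulrBr !mulr_natr; congr (_ - _).
by case: k => [|k] //=; rewrite mulr0n.
Qed.

Let bin_gt0R k n : (k <= n)%N -> 0 < 'C(n, k)%:R :> R.
Proof. by rewrite ltr0n bin_gt0. Qed.

Lemma mul_bin_downR k n : (k <= n)%N ->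
  n%:R * 'C(n.-1, k)%:R = (n%:R - k%:R) * 'C(n, k)%:R :> R.
Proof. by move=> kn; rewrite -natrB// -!natrM mul_bin_down. Qed.

Lemma kraw_next k x y : (k < x + y)%N ->
  kraw k.+1 x y = - (x%:R / (x + y)%:R * kraw k x.-1 y)
                  + y%:R / (x + y)%:R * kraw k x y.-1.
Proof.
move=> kn; rewrite /kraw; set n := (x + y)%N.
have n0 : n%:R != 0 :> R by rewrite pnatr_eq0 /n; lia.
have Cn : 'C(n.-1, k)%:R != 0 :> R by rewrite gt_eqF// bin_gt0R// /n; lia.
have k0 : k.+1%:R != 0 :> R by rewrite pnatr_eq0.
have CE : 'C(n, k.+1)%:R = n%:R * 'C(n.-1, k)%:R / k.+1%:R :> R.
  by rewrite -natrM mul_bin_diag natrM mulrAC mulfV ?mul1r.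
have eE := kcoef_next k x y.
have -> : (kpoly x y)`_k.+1 =
   (- (x%:R * (kpoly x.-1 y)`_k) + y%:R * (kpoly x y.-1)`_k) / k.+1%:R.
  by rewrite -eE mulfK.
have xE : x%:R * ((kpoly x.-1 y)`_k / 'C(x.-1 + y, k)%:R) =
          x%:R * ((kpoly x.-1 y)`_k / 'C(n.-1, k)%:R) :> R.
  by rewrite /n; case: x {kn n n0 Cn CE eE} => [|x]; rewrite ?mul0r.
have yE : y%:R * ((kpoly x y.-1)`_k / 'C(x + y.-1, k)%:R) =
          y%:R * ((kpoly x y.-1)`_k / 'C(n.-1, k)%:R) :> R.
  by rewrite /n; case: y {kn n n0 Cn CE eE xE} => [|y]; rewrite ?mul0r ?addnS.
rewrite (mulrAC x%:R) xE (mulrAC y%:R) yE CE.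
by field; rewrite n0 Cn nat1r k0.
Qed.

Lemma kraw_same k x y : (k < x + y)%N ->
  kraw k x y = x%:R / (x + y)%:R * kraw k x.-1 y
                  + y%:R / (x + y)%:R * kraw k x y.-1.
Proof.
move=> kn; rewrite /kraw; set n := (x + y)%N.
have n0 : n%:R != 0 :> R by rewrite pnatr_eq0 /n; lia.
have Cn : 'C(n.-1, k)%:R != 0 :> R by rewrite gt_eqF// bin_gt0R// /n; lia.
have k0 : n%:R - k%:R != 0 :> R.
  by rewrite -natrB ?(ltnW kn)// pnatr_eq0 subn_eq0 -ltnNge.
have CE : 'C(n, k)%:R = n%:R * 'C(n.-1, k)%:R / (n%:R - k%:R) :> R.
  by rewrite mul_bin_downR ?(ltnW kn)// mulrAC mulfV ?mul1r.
have eE := kcoef_same k x y.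
have -> : (kpoly x y)`_k =
   ((x%:R * (kpoly x.-1 y)`_k) + y%:R * (kpoly x y.-1)`_k) / (n%:R - k%:R).
  by rewrite -eE mulfK.
have xE : x%:R * ((kpoly x.-1 y)`_k / 'C(x.-1 + y, k)%:R) =
          x%:R * ((kpoly x.-1 y)`_k / 'C(n.-1, k)%:R) :> R.
  by rewrite /n; case: x {kn n n0 k0 Cn CE eE} => [|x]; rewrite ?mul0r.
have yE : y%:R * ((kpoly x y.-1)`_k / 'C(x + y.-1, k)%:R) =
          y%:R * ((kpoly x y.-1)`_k / 'C(n.-1, k)%:R) :> R.
  by rewrite /n; case: y {kn n n0 k0 Cn CE eE xE} => [|y]; rewrite ?mul0r ?addnS.
rewrite (mulrAC x%:R) xE (mulrAC y%:R) yE CE.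
by field; rewrite n0 Cn k0.
Qed.

Lemma kraw_sub k x y : (k < x + y)%N ->
  kraw k x y - kraw k.+1 x y = 2 * (x%:R / (x + y)%:R) * kraw k x.-1 y.
Proof. by move=> kn; rewrite kraw_next// kraw_same//; ring. Qed.

Lemma kraw_add k x y : (k < x + y)%N ->
  kraw k x y + kraw k.+1 x y = 2 * (y%:R / (x + y)%:R) * kraw k x y.-1.
Proof. by move=> kn; rewrite kraw_next// kraw_same//; ring. Qed.

(** A step of two produces both factors x / n and y / n, so that the increment
    is small at either end of the range of x; at y = 0 the numbers alternate
    between 1 and -1. *)
Lemma kraw_sub2 k x y : (k.+1 < x + y)%N -> (0 < y)%N ->
  kraw k x y - kraw k.+2 x y =
  4 * (x%:R / (x + y).-1%:R) * (y%:R / (x + y)%:R) * kraw k x.-1 y.-1.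
Proof.
move=> kn y0.
have -> : kraw k x y - kraw k.+2 x y =
  (kraw k x y + kraw k.+1 x y) - (kraw k.+1 x y + kraw k.+2 x y) by ring.
rewrite !kraw_add ?(ltnW kn)// -mulrBr kraw_sub; last by lia.
by rewrite (_ : (x + y.-1 = (x + y).-1)%N); [ring|lia].
Qed.

Lemma kraw_sym k x y : kraw k y x = (-1) ^+ k * kraw k x y.
Proof.
suff E : forall (x y k : nat), (kpoly y x)`_k = (-1) ^+ k * (kpoly x y)`_k.
  by rewrite /kraw addnC E mulrA.
elim=> [|{}x IHx] {}y.
  elim: y => [|{}y IHy] {}k; first by rewrite /kpoly !expr0 mulr1 coef1; case: k => [|k]; rewrite ?expr0 ?mul1r ?mulr0.
  have -> : kpoly y.+1 0 = (1 - 'X) * kpoly y 0 by rewrite /kpoly exprS; ring.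
  have -> : kpoly 0 y.+1 = (1 + 'X) * kpoly 0 y by rewrite /kpoly exprS; ring.
  rewrite mulrBl mulrDl !mul1r coefB coefD !coefXM !IHy.
  by case: k => [|k] /=; rewrite ?IHy ?exprS; ring.
move=> {}k.
have -> : kpoly y x.+1 = (1 + 'X) * kpoly y x by rewrite /kpoly exprS; ring.
have -> : kpoly x.+1 y = (1 - 'X) * kpoly x y by rewrite /kpoly exprS; ring.
rewrite mulrBl mulrDl !mul1r coefB coefD !coefXM !IHx.
by case: k => [|k] /=; rewrite ?IHx ?exprS; ring.
Qed.

Lemma kcoef_bound k x y : `|(kpoly x y)`_k| <= 'C(x + y, k)%:R.
Proof.
elim: x k => [|x IHx] k.
  elim: y k => [|y IHy] k; first by rewrite /kpoly !expr0 mulr1 coef1 bin0n normr_nat.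
  rewrite /kpoly expr0 mul1r exprS mulrDl mul1r coefD coefXM addnS.
  have E : (1 + 'X) ^+ y = kpoly 0 y by rewrite /kpoly mul1r.
  case: k => [|k] /=; first by rewrite addr0 bin0 E (le_trans (IHy 0))// bin0.
  rewrite binS natrD E (le_trans (ler_normD _ _))// lerD//; exact: IHy.
rewrite /kpoly exprS -mulrA -/(kpoly x y) mulrDl mul1r mulNr coefD coefN coefXM addSn.
case: k => [|k] /=; first by rewrite oppr0 addr0 bin0 (le_trans (IHx 0))// bin0.
rewrite binS natrD (le_trans (ler_normB _ _))// lerD//; exact: IHx.
Qed.

Lemma kraw_le1 k x y : `|kraw k x y| <= 1.
Proof.
rewrite /kraw normrM normfV normr_nat.
have [kn|kn] := leqP k (x + y).
  by rewrite ler_pdivrMr ?bin_gt0R// mul1r kcoef_bound.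
by rewrite bin_small// invr0 mulr0.
Qed.

(** This is where cancellation enters: a k-set that meets a pair formed by one
    point of each sign in exactly one point is compensated by the set meeting it
    in the other point. *)
Lemma kcoef_pair k x y : (kpoly x.+1 y.+1)`_k =
  (kpoly x y)`_k - (if (k < 2)%N then 0 else (kpoly x y)`_(k - 2)).
Proof.
have -> : kpoly x.+1 y.+1 = kpoly x y - 'X^2 * kpoly x y.
  by rewrite /kpoly !exprS; ring.
by rewrite coefB coefXnM.
Qed.

Lemma expR_half : expR (2^-1) <= 2 :> R.
Proof.
have := expR_ge1Dx (- 2^-1 : R); rewrite expRN => h.
have e0 : 0 < expR (2^-1 : R) by exact: expR_gt0.
have : 2^-1 <= (expR 2^-1)^-1 :> R by apply: le_trans h; lra.
by rewrite lef_pV2 ?posrE.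
Qed.

(** Every pair that is split off gains a factor (1 - q)^2 + 2 q^2, where
    q = k / (x + y): the first term comes from the sets avoiding the pair, the
    second from those containing it.  For q <= 1/2 this is at most exp(- q / 2). *)
Lemma kcoef_decay m k x y : (m <= x)%N -> (m <= y)%N -> (2 * m + 2 * k <= x + y)%N ->
  `|(kpoly x y)`_k| <= 'C(x + y, k)%:R * expR (- (k%:R * m%:R / (2 * (x + y)%:R))).
Proof.
elim: m x y k => [|m IH] x y k mx my mk.
  by rewrite mulr0 mul0r oppr0 expR0 mulr1 kcoef_bound.
case: x y mx my mk => // x [//|y] mx my mk.
rewrite kcoef_pair.
set N := (x + y)%N; have -> : (x.+1 + y.+1 = N.+2)%N by rewrite /N; lia.
have kN : (k <= N)%N by rewrite /N; lia.
set E := expR (- (k%:R * m%:R / (2 * N.+2%:R))) : R.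
have E0 : 0 < E by exact: expR_gt0.
set q : R := k%:R / N.+2%:R.
have q0 : 0 <= q by rewrite divr_ge0.
have q2 : q <= 2^-1 by rewrite ler_pdivrMr// ler_pdivlMl// -natrM ler_nat /N; lia.
set C := 'C(N.+2, k)%:R : R.
have C0 : 0 < C by apply: bin_gt0R; lia.
have N0 : 0 < N.+2%:R :> R by [].
have A : `|(kpoly x y)`_k| <= C * (1 - q) ^+ 2 * E.
  apply: (le_trans (IH x y k _ _ _)); [lia..|]; rewrite -/N.
  apply: ler_pM => //.
    have h1 := @mul_bin_downR k N.+2 ltac:(lia).
    have h2 := @mul_bin_downR k N.+1 ltac:(lia).
    have -> : 'C(N, k)%:R = C * (1 - q) * ((N.+1%:R - k%:R) / N.+1%:R).
      have e2 : 'C(N, k)%:R = (N.+1%:R - k%:R) * 'C(N.+1, k)%:R / N.+1%:R :> R.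
        by rewrite -h2 mulrAC mulfV ?mul1r ?pnatr_eq0.
      have e1 : 'C(N.+1, k)%:R = (N.+2%:R - k%:R) * C / N.+2%:R :> R.
        by rewrite -h1 mulrAC mulfV ?mul1r ?pnatr_eq0.
      have a0 : N.+1%:R != 0 :> R by rewrite pnatr_eq0.
      have b0 : N.+2%:R != 0 :> R by rewrite pnatr_eq0.
      rewrite e2 e1 /q; move: N.+1%:R N.+2%:R a0 b0 => a b a0 b0.
      by field; rewrite a0 b0.
    rewrite expr2 (mulrA C (1 - q) (1 - q)) ler_wpM2l//; first by rewrite mulr_ge0// ?ltW//; lra.
    rewrite mulrBl mulfV ?pnatr_eq0// lerB//.
    by rewrite /q ler_wpM2l// lef_pV2 ?posrE// ler_nat.
  rewrite ler_expR lerN2; case: m {IH E E0} mx my mk => [|m] mx my mk; first by rewrite !mulr0 !mul0r.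
  rewrite ler_wpM2l// lef_pV2 ?posrE ?mulr_gt0 ?ltr0n ?ler_pM2l ?ler_nat//; rewrite /N; lia.
(* The ratio k / n decreases when k and n both decrease by 2; the factor 2 bounds
   the resulting loss, at most 1/2 in the exponent. *)
have B : (1 < k)%N -> `|(kpoly x y)`_(k - 2)| <= C * (2 * q ^+ 2) * E.
  move=> k2; apply: (le_trans (IH x y (k - 2)%N _ _ _)); [lia..|]; rewrite -/N.
  have -> : C * (2 * q ^+ 2) * E = (C * q ^+ 2) * (2 * E) by ring.
  apply: ler_pM => //.
    have h1 : k%:R * C = N.+2%:R * 'C(N.+1, k.-1)%:R.
      by rewrite /C -!natrM mul_bin_diag prednK//; lia.
    have h2 : k.-1%:R * 'C(N.+1, k.-1)%:R = N.+1%:R * 'C(N, k - 2)%:R :> R.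
      by rewrite -!natrM (mul_bin_diag N.+1) (_ : (k - 2).+1 = k.-1)//; lia.
    have -> : 'C(N, k - 2)%:R = C * q * (k.-1%:R / N.+1%:R).
      apply/eqP; rewrite -(inj_eq (@mulfI _ (N.+1%:R) _))// ?pnatr_eq0//.
      rewrite -h2 -(inj_eq (@mulfI _ (N.+2%:R) _))// ?pnatr_eq0//.
      rewrite mulrCA -h1 /q.
      have a0 : N.+1%:R != 0 :> R by rewrite pnatr_eq0.
      have b0 : N.+2%:R != 0 :> R by rewrite pnatr_eq0.
      move: N.+1%:R N.+2%:R a0 b0 => a b a0 b0.
      by apply/eqP; field; rewrite a0 b0.
    rewrite expr2 (mulrA C q q) ler_wpM2l//; first by rewrite mulr_ge0// ltW.
    rewrite /q ler_pdivrMr// mulrAC ler_pdivlMr// -!natrM ler_nat; nia.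
  apply: (@le_trans _ _ (expR (2^-1) * E)); last by rewrite ler_wpM2r ?expR_half// ltW.
  rewrite -expRD ler_expR.
  case: m {IH E E0 A} mx my mk => [|m] mx my mk; first by rewrite !mulr0 !mul0r oppr0; lra.
  have Np : (0 < N)%N by rewrite /N; lia.
  rewrite natrB//.
  rewrite -subr_ge0 (_ : _ - _ = 2^-1 - (m.+1%:R / N%:R) * ((N.+2%:R - k%:R) / N.+2%:R)); last first.
    by rewrite -!natr1; field; rewrite ?pnatr_eq0 -?lt0n Np /= natr1 natr1 pnatr_eq0.
  rewrite subr_ge0 -[leRHS]mulr1; apply: ler_pM => //; rewrite ?divr_ge0//.
  - rewrite subr_ge0 ler_nat; lia.
  - rewrite ler_pdivrMr ?ltr0n// ler_pdivlMl// -natrM ler_nat /N; lia.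
  - by rewrite ler_pdivrMr// mul1r gerBl.
have AB : `|(kpoly x y)`_k - (if (k < 2)%N then 0 else (kpoly x y)`_(k - 2))| <=
   C * (1 - q) ^+ 2 * E + C * (2 * q ^+ 2) * E.
  apply: (le_trans (ler_normB _ _)); apply: lerD => //.
  case: ltnP => [_|/B//]; rewrite normr0.
  by rewrite !mulr_ge0// ?ltW ?exprn_gt0//.
apply: (le_trans AB); rewrite -mulrDl -mulrDr -mulrA ler_wpM2l//.
apply: (@le_trans _ _ (expR (- (q / 2)) * E)).
  apply: ler_wpM2r; first exact: ltW.
  apply: le_trans (expR_ge1Dx _); nra.
rewrite -expRD ler_expR -subr_ge0.
have b0 : N.+2%:R != 0 :> R by rewrite pnatr_eq0.
rewrite (_ : _ - _ = 0)// /q -(natr1 m).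
by move: N.+2%:R b0 => b b0; field.
Qed.

(** Half of the x available pairs suffice, and using only these leaves room for
    the side condition of [kcoef_decay]. *)
Lemma kraw_decay k x y : (x <= y)%N -> (4 * k + 2 <= x + y)%N ->
  `|kraw k x y| <= expR (- (k%:R * x%:R / (4 * (x + y)%:R))).
Proof.
move=> xy kn; rewrite /kraw normrM normfV normr_nat ler_pdivrMr; last by apply: bin_gt0R; lia.
rewrite mulrC; apply: (le_trans (@kcoef_decay (uphalf x) _ _ _ _ _ _)); [lia..|].
rewrite ler_wpM2l// ler_expR lerN2.
rewrite -subr_ge0 (_ : _ - _ = k%:R * ((uphalf x)%:R * 2 - x%:R) / (4 * (x + y)%:R)).
  rewrite divr_ge0 ?mulr_ge0// subr_ge0 -natrM ler_nat; lia.
by field; rewrite -natrD pnatr_eq0; lia.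
Qed.

End Kraw.

(** * Square-summability of the multipliers *)

Section Scalar.
Variable R : realType.
Implicit Types (k x y n L l e : nat) (th z : R).
Local Notation kraw := (kraw R).

(** The term of index l is at most 1/(1 + l th) - 1/(1 + (l+1) th), and these
    differences telescope. *)
Lemma sum_inv_sq th L : 0 <= th ->
  \sum_(l < L) th / (1 + l.+1%:R * th) ^+ 2 <= 1.
Proof.
move=> th0; suff: \sum_(l < L) th / (1 + l.+1%:R * th) ^+ 2 <= 1 - (1 + L%:R * th)^-1.
  move/le_trans; apply; rewrite gerBl invr_ge0 addr_ge0// mulr_ge0//.
elim: L => [|L IH]; first by rewrite big_ord0 mul0r addr0 invr1 subrr.
rewrite big_ord_recr /= (le_trans (lerD IH (lexx _)))//.
have b0 : 0 <= L%:R * th by rewrite mulr_ge0.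
rewrite -(natr1 L) mulrDl mul1r addrA.
set b := 1 + L%:R * th.
have b1 : 0 < b by rewrite /b; lra.
have b2 : 0 < b + th by lra.
rewrite -subr_ge0 (_ : _ - _ = th ^+ 2 / (b * (b + th) ^+ 2)).
  by rewrite divr_ge0 ?sqr_ge0// mulr_ge0 ?sqr_ge0// ltW.
by field; rewrite !gt_eqF.
Qed.

Lemma expRN_le z : 0 <= z -> expR (- z) <= 27 / (1 + z) ^+ 3.
Proof.
move=> z0; rewrite expRN -[27]invrK -invfM lef_pV2 ?posrE ?expR_gt0//; last first.
  by rewrite mulr_gt0// exprn_gt0//; lra.
have -> : expR z = expR (z / 3) ^+ 3 by rewrite -expRM_natl; congr expR; field.
have h : 1 + z / 3 <= expR (z / 3) by exact: expR_ge1Dx.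
have := @lerXn2r _ 3%N (1 + z / 3) (expR (z / 3)).
rewrite !nnegrE expR_ge0 => /(_ _ isT h) h3.
apply: le_trans (h3 _); last by lra.
have -> : (1 + z / 3) ^+ 3 = 27^-1 * (3 + z) ^+ 3 by field.
by rewrite ler_wpM2l// lerXn2r// ?nnegrE; lra.
Qed.

(** [kraw_decay] applied to the factor in [kraw_sub2]; replacing (k, x - 1) by
    (k + 2, x) in the exponent costs at most exp(1/2) <= 2. *)
Lemma kraw_sub2_le k x y : (x <= y)%N -> (4 * k + 10 <= x + y)%N ->
  `|kraw k x y - kraw k.+2 x y| <=
  16 * (x%:R / (x + y)%:R) * expR (- (k.+2%:R * (x%:R / (x + y)%:R) / 4)).
Proof.
move=> xy kn.
case: x xy kn => [|x] xy kn.
  by rewrite kraw_sub2 ?mul0r ?mulr0 ?mul0r ?normr0//; lia.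
case: y xy kn => [|y] xy kn; first lia.
rewrite kraw_sub2 //; last by lia.
rewrite normrM ger0_norm; last by rewrite !mulr_ge0// invr_ge0.
rewrite !succnK; set n := (x.+1 + y.+1)%N.
have n0 : 0 < n%:R :> R by rewrite ltr0n.
have nE : n%:R = (x + y)%:R + 2 :> R by rewrite -natrD /n; congr (_%:R); lia.
have N0 : 8 <= (x + y)%:R :> R by rewrite ler_nat; lia.
set th : R := x.+1%:R / n%:R.
have thE : x.+1%:R = th * n%:R by rewrite mulfVK ?gt_eqF.
have th0 : 0 <= th by rewrite divr_ge0.
apply: (@le_trans _ _ ((8 * th) * (2 * expR (- (k.+2%:R * th / 4))))); last by lra.
apply: ler_pM; rewrite ?mulr_ge0 ?invr_ge0//.
  rewrite -[leRHS]mulr1; apply: ler_pM; rewrite ?mulr_ge0 ?invr_ge0//.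
    rewrite (_ : n.-1%:R = (x + y)%:R + 1); last by rewrite natr1 /n addSn addnS.
    have -> : 8 * th = 4 * (2 * th) by ring.
    rewrite ler_wpM2l// ler_pdivrMr; last by lra.
    rewrite thE nE; nra.
  by rewrite ler_pdivrMr// mul1r ler_nat /n; lia.
apply: (@le_trans _ _ (expR (2^-1) * expR (- (k.+2%:R * th / 4)))); last first.
  by apply: ler_wpM2r; [exact: expR_ge0|exact: expR_half].
rewrite -expRD; apply: (le_trans (@kraw_decay R _ _ _ _ _)); [lia|lia|].
rewrite ler_expR.
have -> : x%:R = th * n%:R - 1 by rewrite -thE -(natr1 x); lra.
have kn' : 4 * k%:R + 10 <= n%:R :> R by rewrite -natrM -natrD ler_nat.
have thn : th * n%:R >= 1 by rewrite -thE ler1n.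
have th2 : th <= 2^-1 by rewrite ler_pdivrMr// ler_pdivlMl// -natrM ler_nat /n; lia.
apply: (@le_trans _ _ (- (k%:R * (th * n%:R - 1) / (4 * n%:R)))).
  rewrite lerN2; apply: ler_wpM2l; first by rewrite mulr_ge0//; lra.
  by rewrite lef_pV2 ?posrE ?mulr_gt0//; lra.
have -> : k%:R * (th * n%:R - 1) / (4 * n%:R) = k%:R * th / 4 - (k%:R / n%:R) / 4.
  by field; rewrite gt_eqF.
have : k%:R / n%:R <= 4^-1 :> R by rewrite ler_pdivrMr//; lra.
rewrite -(natr1 k.+1) -(natr1 k); lra.
Qed.

(** With th = min(x, y) / n the summand is of order l th^2 exp(- l th), which is
    of order th / (1 + l th)^2. *)
Lemma kraw_diff_sum e x y L : (e <= 1)%N -> (8 * L + 4 * e + 2 <= x + y)%N ->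
  \sum_(l < L) l.+1%:R * (kraw (e + l.*2) x y - kraw (e + l.*2).+2 x y) ^+ 2 <= 16 ^+ 2 * 27.
Proof.
wlog xy : x y / (x <= y)%N => [W|] e1 Ln.
  have [xy|yx] := leqP x y; first exact: W.
  have := W y x (ltnW yx) e1; rewrite (addnC y) => /(_ Ln); apply: le_trans.
  apply: ler_sum => l _; rewrite ler_wpM2l//.
  rewrite (kraw_sym R (e + l.*2) x y) (kraw_sym R (e + l.*2).+2 x y).
  rewrite (_ : (-1) ^+ (e + l.*2).+2 = (-1) ^+ (e + l.*2)); last by rewrite !exprS !mulN1r opprK.
  by rewrite -mulrBr exprMn sqrr_sign mul1r.
set th : R := x%:R / (x + y)%:R.
have th0 : 0 <= th by rewrite divr_ge0.
apply: (@le_trans _ _ (\sum_(l < L) (16 ^+ 2 * 27) * (th / (1 + l.+1%:R * th) ^+ 2))); last first.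
  rewrite -mulr_sumr; apply: ler_piMr; [exact: mulr_ge0|exact: sum_inv_sq].
apply: ler_sum => l _.
have lL := ltn_ord l.
have kn : (4 * (e + l.*2) + 10 <= x + y)%N by move: Ln lL; clear; lia.
have h := kraw_sub2_le xy kn.
rewrite -/th in h.
set z := l.+1%:R * th; have z0 : 0 <= z by rewrite mulr_ge0.
have h2 : `|kraw (e + l.*2) x y - kraw (e + l.*2).+2 x y| <= 16 * th * expR (- (z / 2)).
  apply: (le_trans h); apply: ler_wpM2l; first by rewrite mulr_ge0.
  rewrite ler_expR lerN2 (_ : z / 2 = (l.+1.*2)%:R * th / 4); last first.
    by rewrite -muln2 natrM /z; field.
  by rewrite !ler_wpM2r// ler_nat; lia.
rewrite -real_normK ?num_real//.
have h3 : `|kraw (e + l.*2) x y - kraw (e + l.*2).+2 x y| ^+ 2 <= 16 ^+ 2 * th ^+ 2 * expR (- z).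
  apply: (@le_trans _ _ ((16 * th * expR (- (z / 2))) ^+ 2)).
    by rewrite lerXn2r// ?nnegrE// !mulr_ge0// expR_ge0.
  rewrite !exprMn -expRM_natl.
  by rewrite (_ : 2 * - (z / 2) = - z); [lra|field].
apply: (le_trans (ler_wpM2l (ler0n _ _) h3)).
have h4 := expRN_le z0.
have -> : l.+1%:R * (16 ^+ 2 * th ^+ 2 * expR (- z)) = 16 ^+ 2 * th * (z * expR (- z)).
  by rewrite /z; ring.
have -> : (16 ^+ 2 * 27) * (th / (1 + z) ^+ 2) = 16 ^+ 2 * th * (27 / (1 + z) ^+ 2) by ring.
apply: ler_wpM2l; first exact: mulr_ge0.
apply: (@le_trans _ _ (z * (27 / (1 + z) ^+ 3))); first by rewrite ler_wpM2l.
have -> : 27 / (1 + z) ^+ 2 = (1 + z) * (27 / (1 + z) ^+ 3) by field; lra.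
by rewrite ler_wpM2r; [|rewrite divr_ge0// exprn_ge0; lra|lra].
Qed.

Lemma bernoulli_le (q : R) x : 0 <= q <= 1 -> 1 - x%:R * q <= (1 - q) ^+ x.
Proof.
move=> /andP[q0 q1]; elim: x => [|x IH]; first by rewrite mul0r subr0 expr0.
rewrite exprS; apply: (@le_trans _ _ ((1 - q) * (1 - x%:R * q))); last first.
  by rewrite ler_wpM2l//; lra.
have : 0 <= x%:R * q ^+ 2 by rewrite mulr_ge0 ?sqr_ge0.
rewrite -(natr1 x); nra.
Qed.

Lemma pow1B_le_exp (q : R) x : 0 <= q <= 1 -> (1 - q) ^+ x <= expR (- (x%:R * q)).
Proof.
move=> /andP[q0 q1]; rewrite -mulrN expRM_natl.
by rewrite lerXn2r// ?nnegrE ?expR_ge0//; [lra|exact: expR_ge1Dx].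
Qed.

Lemma kraw_sub1_le k x y : (k <= x + y)%N ->
  `|kraw k x y - 1| <= 2 * k%:R * (x%:R / (x + y)%:R).
Proof.
elim: k => [|k IH] kn.
  rewrite mulr0 mul0r /kraw bin0 divr1 /kpoly.
  by rewrite -horner_coef0 hornerM !horner_exp !hornerE /= !(subr0, addr0, expr1n) mulr1 subrr normr0.
have -> : kraw k.+1 x y - 1 = (kraw k x y - 1) - (kraw k x y - kraw k.+1 x y) by ring.
rewrite kraw_sub// (le_trans (ler_normB _ _))//.
have -> : 2 * k.+1%:R * (x%:R / (x + y)%:R) =
  2 * k%:R * (x%:R / (x + y)%:R) + 2 * (x%:R / (x + y)%:R) :> R by rewrite -(natr1 k); ring.
apply: lerD; first by apply: IH; lia.
rewrite normrM ger0_norm ?mulr_ge0//.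
by apply: ler_piMr; [rewrite !mulr_ge0|exact: kraw_le1].
Qed.

(** Multiplier of the noise operator of rate k / (x + y), to which its mirror
    image under the exchange of x and y is added with the sign that the exchange
    produces in [kraw]. *)
Definition symnoise_mult k x y : R := (1 - k%:R / (x + y)%:R) ^+ x + (-1) ^+ k * (1 - k%:R / (x + y)%:R) ^+ y.

Lemma symnoise_mult_sym k x y : symnoise_mult k y x = (-1) ^+ k * symnoise_mult k x y.
Proof.
rewrite /symnoise_mult addnC mulrDr mulrA -exprD addnn -muln2 mulnC exprM sqrrN !expr1n mul1r.
by rewrite addrC.
Qed.

(** Put z = (l+1) x / n.  For z <= 1 the Krawtchouk number and the noise
    multiplier are both within O(z) of 1, and for z >= 1 both are O(exp(- z / 2)).
    The mirror image is at most exp(- l), because y >= n / 2. *)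
Lemma kraw_symnoise_le e x y l : (e <= 1)%N -> (x <= y)%N -> (4 * (e + l.*2) + 2 <= x + y)%N ->
  (kraw (e + l.*2) x y - symnoise_mult (e + l.*2) x y) ^+ 2 / l.+1%:R <=
  864 * ((x%:R / (x + y)%:R) / (1 + l.+1%:R * (x%:R / (x + y)%:R)) ^+ 2) +
  8 * (1 / (1 + l.+1%:R * 1) ^+ 2).
Proof.
move=> e1 xy kn; have nyk : (l * (x + y) <= y * (e + l.*2))%N by clear kn e1; nia.
have lk' : (2 * l <= e + l.*2 <= 2 * l.+1)%N by clear -e1; lia.
have kn' : (e + l.*2 <= x + y)%N by clear -kn; lia.
set k := (e + l.*2)%N in kn kn' nyk lk' *.
set n := (x + y)%N in kn kn' nyk *.
have n0 : 0 < n%:R :> R by rewrite ltr0n; lia.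
set th : R := x%:R / n%:R.
have th0 : 0 <= th by rewrite divr_ge0.
have th2 : th <= 2^-1 by rewrite ler_pdivrMr// ler_pdivlMl// -natrM ler_nat /n; lia.
set q : R := k%:R / n%:R.
have q01 : 0 <= q <= 1.
  by rewrite divr_ge0//= ler_pdivrMr// mul1r ler_nat.
set z := l.+1%:R * th; have z0 : 0 <= z by rewrite mulr_ge0.
set p := (1 - q) ^+ x; set p' := (1 - q) ^+ y.
have p0 : 0 <= p by rewrite exprn_ge0//; lra.
have p'0 : 0 <= p' by rewrite exprn_ge0//; lra.
have xq : x%:R * q = k%:R * th by rewrite /q /th; ring.
have kl : k%:R <= 2 * l.+1%:R :> R by rewrite -natrM ler_nat; case/andP: lk'.
have lk : 2 * l%:R <= k%:R :> R by rewrite -natrM ler_nat; case/andP: lk'.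
have A1 : `|kraw k x y - p| <= 6 * z.
  have -> : kraw k x y - p = (kraw k x y - 1) + (1 - p) by ring.
  apply: (le_trans (ler_normD _ _)).
  have h1 : `|kraw k x y - 1| <= 2 * k%:R * th by apply: kraw_sub1_le.
  have p1 : p <= 1 by rewrite exprn_ile1//; lra.
  have h2 : 1 - k%:R * th <= p by rewrite -xq bernoulli_le.
  have h3 : k%:R * th <= 2 * z by rewrite /z mulrA ler_wpM2r.
  by rewrite (ger0_norm (_ : 0 <= 1 - p)); lra.
have A2 : `|kraw k x y - p| <= 4 * expR (- (z / 2)).
  have h1 : `|kraw k x y| <= expR (- (l%:R * th / 2)).
    apply: (le_trans (@kraw_decay R _ _ _ _ _)); rewrite -/n//.
    rewrite ler_expR lerN2 (_ : k%:R * x%:R / (4 * n%:R) = k%:R * th / 4); last first.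
      by rewrite /th; field; rewrite gt_eqF.
    have := ler_wpM2r th0 lk; lra.
  have h2 : `|p| <= expR (- (l%:R * th / 2)).
    rewrite ger0_norm// (le_trans (pow1B_le_exp _ q01))// xq ler_expR lerN2.
    have := ler_wpM2r th0 lk; have : 0 <= l%:R * th by rewrite mulr_ge0.
    lra.
  have h3 : expR (- (l%:R * th / 2)) <= 2 * expR (- (z / 2)).
    apply: (@le_trans _ _ (expR (2^-1) * expR (- (z / 2)))); last first.
      by apply: ler_wpM2r; [exact: expR_ge0|exact: expR_half].
    by rewrite -expRD ler_expR /z -(natr1 l); lra.
  apply: (le_trans (ler_normB _ _)); lra.
have B1 : (kraw k x y - p) ^+ 2 <= 432 * (z / (1 + z) ^+ 2).
  rewrite -real_normK ?num_real//.
  have z1 : 0 < (1 + z) ^+ 2 by rewrite exprn_gt0//; lra.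
  rewrite mulrA ler_pdivlMr//.
  have [zle|zge] := leP z 1.
    apply: (@le_trans _ _ ((6 * z) ^+ 2 * 4)); last by nra.
    apply: ler_pM; rewrite ?sqr_ge0//; first by rewrite lerXn2r// nnegrE; lra.
    nra.
  apply: (@le_trans _ _ ((16 * (27 / (1 + z) ^+ 3)) * (1 + z) ^+ 2)).
    apply: ler_wpM2r; first exact: ltW.
    apply: (@le_trans _ _ ((4 * expR (- (z / 2))) ^+ 2)).
      by rewrite lerXn2r// ?nnegrE// mulr_ge0// expR_ge0.
    rewrite exprMn -expRM_natl (_ : 2 * - (z / 2) = - z); last by field.
    have := expRN_le z0; lra.
  rewrite (_ : _ * _ = 432 / (1 + z)); last by field; lra.
  by rewrite ler_pdivrMr; nra.
have B2 : p' <= (l.+1%:R)^-1.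
  apply: (le_trans (pow1B_le_exp _ q01)).
  apply: (@le_trans _ _ (expR (- l%:R))).
    by rewrite ler_expR lerN2 /q mulrA ler_pdivlMr// -!natrM ler_nat.
  rewrite expRN lef_pV2 ?posrE ?expR_gt0// -nat1r; exact: expR_ge1Dx.
have l0 : 0 < l.+1%:R :> R by [].
rewrite mul1r mulr1.
have -> : kraw k x y - symnoise_mult k x y = (kraw k x y - p) - (-1) ^+ k * p'.
  by rewrite /symnoise_mult -/n -/q -/p -/p'; ring.
set D := kraw k x y - p in B1 *.
have S : (D - (-1) ^+ k * p') ^+ 2 <= 2 * D ^+ 2 + 2 * p' ^+ 2.
  have -> : p' ^+ 2 = ((-1) ^+ k * p') ^+ 2.
    by rewrite exprMn sqrr_sign mul1r.
  have := sqr_ge0 (D + (-1) ^+ k * p'); nra.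
rewrite ler_pdivrMr//; apply: (le_trans S).
rewrite [leRHS]mulrDl; apply: lerD.
  have -> : 864 * (th / (1 + z) ^+ 2) * l.+1%:R = 2 * (432 * (z / (1 + z) ^+ 2)).
    have zE : z = l.+1%:R * th by [].
    by move: ((1 + z) ^+ 2)^-1 => w; rewrite zE; ring.
  lra.
have B3 : p' ^+ 2 <= (l.+1%:R)^-1 ^+ 2 by rewrite lerXn2r// nnegrE// invr_ge0.
apply: (@le_trans _ _ (2 * (l.+1%:R)^-1 ^+ 2)); first exact: ler_wpM2l.
move: (l.+1%:R : R) l0 (ler1n R l.+1) => a a0; rewrite ltn0Sn => a1.
have a3 : (1 + a) ^+ 2 <= 4 * a ^+ 3.
  apply: (@le_trans _ _ ((2 * a) ^+ 2)); first by rewrite lerXn2r// ?nnegrE; lra.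
  rewrite exprMn (_ : 2 ^+ 2 = 4); last by ring.
  by rewrite ler_wpM2l// ler_weXn2l.
rewrite -subr_ge0 (_ : _ - _ = 2 * (4 * a ^+ 3 - (1 + a) ^+ 2) / (a ^+ 2 * (1 + a) ^+ 2)).
  by apply: divr_ge0; apply: mulr_ge0; rewrite ?sqr_ge0 ?subr_ge0.
by field; lra.
Qed.

Lemma kraw_symnoise_sum e x y L : (e <= 1)%N -> (8 * L + 4 * e <= x + y + 6)%N ->
  \sum_(l < L) (kraw (e + l.*2) x y - symnoise_mult (e + l.*2) x y) ^+ 2 / l.+1%:R <= 872.
Proof.
wlog xy : x y / (x <= y)%N => [W|] e1 Ln.
  have [xy|yx] := leqP x y; first exact: W.
  have := W y x (ltnW yx) e1; rewrite (addnC y) => /(_ Ln); apply: le_trans.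
  apply: ler_sum => l _; rewrite ler_wpM2r ?invr_ge0//.
  rewrite (kraw_sym R _ x y) (symnoise_mult_sym _ x y).
  by rewrite -mulrBr exprMn sqrr_sign mul1r.
have th0 : 0 <= x%:R / (x + y)%:R :> R by rewrite divr_ge0.
apply: (@le_trans _ _ (864 * 1 + 8 * 1)); last by lra.
have s1 := sum_inv_sq L th0; have s2 := @sum_inv_sq 1 L ler01.
apply: (le_trans _ (lerD (ler_wpM2l (ler0n _ 864) s1) (ler_wpM2l (ler0n _ 8) s2))).
rewrite !mulr_sumr -big_split /=; apply: ler_sum => l _.
by apply: kraw_symnoise_le => //; have := ltn_ord l; lia.
Qed.

End Scalar.

(** * Summation by parts *)

Section SumSq.
Variable R : realType.

Lemma sqr_wsum_le (I : Type) (s : seq I) (w a : I -> R) : (forall i, 0 <= w i) ->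
  (\sum_(i <- s) w i * a i) ^+ 2 <= (\sum_(i <- s) w i) * \sum_(i <- s) w i * a i ^+ 2.
Proof.
move=> w0; elim: s => [|i s IH]; first by rewrite !big_nil expr0n mul0r.
rewrite !big_cons; set W := \sum_(j <- s) w j; set S := \sum_(j <- s) w j * a j ^+ 2.
set B := \sum_(j <- s) w j * a j.
have W0 : 0 <= W by exact: sumr_ge0.
have S0 : 0 <= S by apply: sumr_ge0 => j _; rewrite mulr_ge0 ?sqr_ge0.
have wi := w0 i.
suff : 0 <= W * a i ^+ 2 + S - 2 * a i * B.
  move=> h; have := mulr_ge0 wi h; rewrite -/W -/S -/B in IH; nra.
have -> : W * a i ^+ 2 + S - 2 * a i * B = \sum_(j <- s) w j * (a i - a j) ^+ 2.
  rewrite /W /S /B mulr_suml mulr_sumr -!big_split -sumrB /=.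
  by apply: eq_bigr => j _; ring.
by apply: sumr_ge0 => j _; rewrite mulr_ge0 ?sqr_ge0.
Qed.

Lemma sqr_sum_le (I : Type) (s : seq I) (a : I -> R) :
  (\sum_(i <- s) a i) ^+ 2 <= (size s)%:R * \sum_(i <- s) a i ^+ 2.
Proof.
have := @sqr_wsum_le I s (fun=> 1) a (fun=> ler01).
under eq_bigr do rewrite mul1r.
by rewrite big_const_seq count_predT iter_addr_0; under [X in _ * X]eq_bigr do rewrite mul1r.
Qed.

(** Summation by parts: (l+1) b_l equals the sum of the r_i, plus the sum of the
    b_i - r_i, minus the sum of the (i+1) (b_i - b_(i+1)).  One term of a sequence
    is thus controlled by a reference sequence and two square functions that
    increase with l. *)
Lemma abel_sqr_le (b r : nat -> R) (M : R) l : (forall i, (i <= l)%N -> r i ^+ 2 <= M) ->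
  b l ^+ 2 <= 3 * (M + \sum_(i < l.+1) (b i - r i) ^+ 2 / i.+1%:R
                     + \sum_(i < l) i.+1%:R * (b i - b i.+1) ^+ 2).
Proof.
move=> rM.
set X := \sum_(i < l.+1) r i; set Y := \sum_(i < l.+1) (b i - r i).
set Z := \sum_(i < l) i.+1%:R * (b i - b i.+1).
set Y2 := \sum_(i < l.+1) (_ : R); set Z2 := \sum_(i < l) (_ : R).
have l0 : 0 < l.+1%:R :> R by [].
have E : l.+1%:R * b l = X + Y - Z.
  have -> : X + Y = \sum_(i < l.+1) b i.
    by rewrite -big_split /=; apply: eq_bigr => i _; ring.
  rewrite /Z {rM X Y Z Y2 Z2 l0}; elim: l => [|l IH].
    by rewrite big_ord0 big_ord_recr big_ord0 /=; ring.
  rewrite big_ord_recr /= [X in _ - X]big_ord_recr /=.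
  have -> : \sum_(i < l.+1) b i = l.+1%:R * b l + \sum_(i < l) i.+1%:R * (b i - b i.+1).
    by rewrite IH subrK.
  by rewrite -(natr1 l.+1); ring.
have HX : X ^+ 2 <= l.+1%:R ^+ 2 * M.
  apply: (le_trans (sqr_sum_le _ _)); rewrite -[index_enum _]/(index_enum 'I_l.+1).
  rewrite [size _](_ : _ = l.+1); last by rewrite -[RHS](card_ord l.+1) cardT enumT.
  rewrite expr2 -mulrA ler_wpM2l//.
  apply: (@le_trans _ _ (\sum_(i < l.+1) M)); last by rewrite sumr_const card_ord mulr_natl.
  by apply: ler_sum => i _; apply: rM; rewrite -ltnS.
have HY : Y ^+ 2 <= l.+1%:R ^+ 2 * Y2.
  apply: (le_trans (sqr_sum_le _ _)).
  rewrite [size _](_ : _ = l.+1); last by rewrite -[RHS](card_ord l.+1) cardT enumT.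
  rewrite expr2 -mulrA ler_wpM2l// /Y2 mulr_sumr; apply: ler_sum => i _.
  rewrite mulrCA; apply: ler_peMr; first exact: sqr_ge0.
  by rewrite ler_pdivlMr// mul1r ler_nat.
have HZ : Z ^+ 2 <= l.+1%:R ^+ 2 * Z2.
  apply: (le_trans (@sqr_wsum_le _ _ (fun i : 'I_l => i.+1%:R) _ _)); first by [].
  apply: ler_wpM2r; first by apply: sumr_ge0 => i _; rewrite mulr_ge0 ?sqr_ge0.
  apply: (@le_trans _ _ (\sum_(i < l) l.+1%:R)).
    by apply: ler_sum => i _; rewrite ler_nat; have := ltn_ord i; lia.
  by rewrite sumr_const card_ord expr2 -[leLHS]mulr_natr ler_wpM2l// ler_nat.
have l20 : 0 < l.+1%:R ^+ 2 :> R by rewrite exprn_gt0.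
rewrite -(ler_pM2l l20) -exprMn E.
have := sqr_ge0 (X - Y); have := sqr_ge0 (X + Z); have := sqr_ge0 (Y + Z).
nra.
Qed.
End SumSq.

(** * Maximal functions of slices of the hypercube *)

Section Cube.
Import fintype finset.
Variables (R : realType) (T : finType).
Implicit Types (A B D K X : {set T}) (g : {set T} -> R).

(** The group law of the hypercube, its points being the subsets of [T]. *)
Definition symd A B : {set T} := [set j | (j \in A) (+) (j \in B)].

Lemma symdC A B : symd A B = symd B A.
Proof. by apply/setP => j; rewrite !inE addbC. Qed.
Lemma symdA A B C : symd A (symd B C) = symd (symd A B) C.
Proof. by apply/setP => j; rewrite !inE addbA. Qed.
Lemma symdAC A B C : symd (symd A B) C = symd (symd A C) B.
Proof. by apply/setP => j; rewrite !inE addbAC. Qed.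
Lemma symdK K : involutive (symd^~ K).
Proof. by move=> A; apply/setP => j; rewrite !inE -addbA addbb addbF. Qed.
Lemma symd_eq0 A B : (symd A B == @finset.set0 T) = (A == B).
Proof.
apply/eqP/eqP => [/setP E|->]; apply/setP => j; last by rewrite !inE addbb.
by have := E j; rewrite !inE; do 2 case: (_ \in _).
Qed.
Lemma symd_sub A B D : A \subset D -> B \subset D -> symd A B \subset D.
Proof.
move=> /subsetP AD /subsetP BD; apply/subsetP => j; rewrite !inE.
by have := AD j; have := BD j; case: (j \in A) => [/= _ /(_ isT)//|/= h _ /h].
Qed.

Definition walsh X A : R := \prod_j (-1) ^+ ((j \in X) && (j \in A)).

Lemma walshC X A : walsh X A = walsh A X.
Proof. by apply: eq_bigr => j _; rewrite andbC. Qed.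
Lemma walshD X A B : walsh X (symd A B) = walsh X A * walsh X B.
Proof.
rewrite -big_split /=; apply: eq_bigr => j _; rewrite !inE.
by do 3 case: (_ \in _); rewrite ?expr0 ?expr1 ?mulr1 ?mul1r ?mulrNN ?mulr1.
Qed.
Lemma walsh_norm X A : `|walsh X A| = 1.
Proof. by rewrite normr_prod big1// => j _; rewrite normrX normrN1 expr1n. Qed.

Lemma sum_walsh A : \sum_X walsh X A = (A == @finset.set0 T)%:R * 2 ^+ #|T|.
Proof.
rewrite (eq_bigr (fun X => \prod_j (if j \in X then (-1) ^+ (j \in A) else 1))); last first.
  by move=> X _; apply: eq_bigr => j _; case: (j \in X).
rewrite -bigA_distr; have [->|/set0Pn[j jA]] := eqVneq A (@finset.set0 T).
  rewrite mul1r -prodr_const; apply: eq_bigr => j _.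
  by rewrite inE expr0.
by rewrite mul0r (bigD1 j)//= jA expr1 addNr mul0r.
Qed.

Definition conv (phi g : {set T} -> R) A : R := \sum_K phi K * g (symd A K).
Definition ft g X : R := \sum_A walsh X A * g A.

Lemma ft_conv phi g X : ft (conv phi g) X = ft phi X * ft g X.
Proof.
rewrite /ft mulr_suml.
under eq_bigr do rewrite mulr_sumr.
rewrite exchange_big; apply: eq_bigr => K _ /=.
rewrite mulr_sumr (reindex_inj (can_inj (symdK K))) /=; apply: eq_bigr => A _.
by rewrite symdK walshD; ring.
Qed.

Lemma parseval g : \sum_X ft g X ^+ 2 = 2 ^+ #|T| * \sum_A g A ^+ 2.
Proof.
transitivity (\sum_A \sum_B g A * g B * \sum_X walsh X (symd A B)).
  under [RHS]eq_bigr do under eq_bigr do rewrite mulr_sumr.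
  under [RHS]eq_bigr do rewrite exchange_big.
  rewrite [RHS]exchange_big; apply: eq_bigr => X _ /=.
  rewrite expr2 /ft mulr_suml; apply: eq_bigr => A _.
  rewrite mulr_sumr; apply: eq_bigr => B _.
  by rewrite walshD; ring.
rewrite mulr_sumr; apply: eq_bigr => A _.
rewrite (bigD1 A)//= [X in _ + X]big1 ?addr0 => [|B BA].
  by rewrite sum_walsh symd_eq0 eqxx mul1r; ring.
by rewrite sum_walsh symd_eq0 eq_sym (negbTE BA) mul0r mulr0.
Qed.

(** Parseval's identity turns a bound on the multipliers at each frequency into
    a bound on the square function. *)
Lemma sum_conv_le (I : finType) (c : I -> R) (phi : I -> {set T} -> R) (C : R) g :
  (forall X, \sum_i c i * ft (phi i) X ^+ 2 <= C) ->
  \sum_A \sum_i c i * conv (phi i) g A ^+ 2 <= C * \sum_A g A ^+ 2.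
Proof.
move=> H; have p0 : 0 < 2 ^+ #|T| :> R by rewrite exprn_gt0.
rewrite -(ler_pM2l p0) mulrCA -parseval exchange_big /= !mulr_sumr.
under eq_bigr do rewrite -mulr_sumr mulrCA -parseval mulr_sumr.
rewrite exchange_big; apply: ler_sum => X _ /=.
under eq_bigr do rewrite ft_conv exprMn mulrA.
by rewrite -mulr_suml; apply: ler_wpM2r; rewrite ?sqr_ge0.
Qed.

Definition slice B (k : nat) K : R := ((K \subset B) && (#|K| == k))%:R / 'C(#|B|, k)%:R.

(** The generating function in k of the sums of [walsh X] over the k-subsets of B
    is the product over B of the factors 1 + z or 1 - z. *)
Lemma ft_slice B k X : ft (slice B k) X = kraw R k #|B :&: X| #|B :\: X|.
Proof.
rewrite /kraw cardsID /ft /slice.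
under eq_bigr do rewrite mulrA.
rewrite -mulr_suml; congr (_ / _).
have -> : kpoly R #|B :&: X| #|B :\: X| =
   \prod_j ((if j \in B then (-1) ^+ (j \in X) *: 'X else 0) + 1).
  rewrite (bigID (mem B)) /= [X in _ * X]big1 ?mulr1 => [|j /negbTE->]; last by rewrite add0r.
  rewrite (bigID (mem X)) /= /kpoly -!prodr_const; congr (_ * _).
    apply: eq_big => [j|j]; first by rewrite inE.
    by rewrite inE => /andP[-> ->]; rewrite expr1 scaleN1r addrC.
  apply: eq_big => [j|j]; first by rewrite inE andbC.
  by rewrite inE => /andP[/negbTE-> ->]; rewrite expr0 scale1r addrC.
rewrite bigA_distr coef_sum; apply: eq_bigr => K _.
have [KB|KB] /= := boolP (K \subset B); last first.
  rewrite mulr0; case/subsetPn: KB => j jK jB.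
  by rewrite (bigD1 j)//= jK (negbTE jB) mul0r coef0.
have -> : \prod_j (if j \in K then if j \in B then (-1) ^+ (j \in X) *: 'X else 0 else 1) =
   walsh X K *: 'X^#|K| :> {poly R}.
  rewrite -big_mkcond /= (eq_bigr (fun j => (-1) ^+ (j \in X) *: 'X)) => [|j jK].
    rewrite scaler_prod prodr_const /walsh; congr (_ *: _).
    by rewrite big_mkcond /=; apply: eq_bigr => j _; case: (j \in K); rewrite ?andbT ?andbF.
  by rewrite (subsetP KB).
by rewrite coefZ coefXn eq_sym.
Qed.

(** Convolution with this density is the conditional expectation given the
    coordinates outside [D]. *)
Definition unif D K : R := (K \subset D)%:R / 2 ^+ #|D|.

Lemma sum_unif D : \sum_K unif D K = 1.
Proof.
rewrite -mulr_suml (_ : \sum_K _ = 2 ^+ #|D|) ?mulfV ?expf_neq0//.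
rewrite -natrX -card_powerset -sum1_card natr_sum [RHS]big_mkcond /=.
by apply: eq_bigr => K _; rewrite inE; case: ifP.
Qed.

Lemma ft_unif D X : ft (unif D) X = [disjoint X & D]%:R.
Proof.
have [/pred0P dj|/pred0Pn[j /andP[/= jX jD]]] := boolP [disjoint X & D].
  rewrite -[RHS](sum_unif D); apply: eq_bigr => K _; rewrite /unif.
  have [/subsetP KD|] := boolP (K \subset D); last by rewrite mul0r mulr0.
  rewrite /walsh big1 ?mul1r// => j _; have /= := dj j; have := KD j.
  by case: (j \in K) => [/(_ isT)->|_]; rewrite ?andbT ?andbF => // ->.
have H : ft (unif D) X = - ft (unif D) X.
  rewrite {1}/ft (reindex_inj (can_inj (symdK [set j]))) /= -sumrN; apply: eq_bigr => K _.
  rewrite walshD; have -> : walsh X [set j] = -1.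
    rewrite /walsh (bigD1 j)//= big1 => [|i /negbTE ij]; last by rewrite inE ij andbF.
    by rewrite inE eqxx jX mulr1 expr1.
  rewrite mulrN1 mulNr /unif; congr (- (_ * ((nat_of_bool _)%:R / _))).
  have jD' : [set j] \subset D by rewrite finset.sub1set.
  apply/idP/idP => [h|h]; last exact: symd_sub.
  by rewrite -[K](symdK [set j]); exact: symd_sub.
by lra.
Qed.

Lemma conv_unif_inv D g A K : K \subset D -> conv (unif D) g (symd A K) = conv (unif D) g A.
Proof.
move=> KD; rewrite /conv [RHS](reindex_inj (can_inj (symdK K))) /=.
apply: eq_bigr => L _; rewrite symdA (symdAC A L); congr (_ * _); rewrite /unif; congr ((nat_of_bool _)%:R / _).
apply/idP/idP => [h|h]; first exact: symd_sub.
by rewrite -[L](symdK K); exact: symd_sub.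
Qed.

Lemma sum_conv_unif D (m g : {set T} -> R) :
  (forall A K, K \subset D -> m (symd A K) = m A) ->
  \sum_A m A * conv (unif D) g A = \sum_A m A * g A.
Proof.
move=> mD; under eq_bigr do rewrite mulr_sumr.
rewrite exchange_big /= -[RHS]mul1r -(sum_unif D) mulr_suml; apply: eq_bigr => K _.
rewrite mulr_sumr (reindex_inj (can_inj (symdK K))) /=; apply: eq_bigr => A _.
rewrite symdK /unif; have [KD|_] := boolP (K \subset D); last by rewrite !mul0r mulr0.
by rewrite mD// mulrCA.
Qed.

Fixpoint runmax (a : nat -> R) n := if n is n'.+1 then Num.max (runmax a n') (a n) else a 0.

Lemma runmax_ge a n i : (i <= n)%N -> a i <= runmax a n.
Proof.
elim: n => [|n IH]; first by rewrite leqn0 => /eqP->.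
rewrite leq_eqVlt => /orP[/eqP->|/IH h] /=; first by rewrite le_max lexx orbT.
by rewrite le_max h.
Qed.

(** A pathwise form of Doob's inequality: the sum on the right is a martingale
    transform of [a], so it has mean zero when [a] is a martingale. *)
Lemma runmax_doob (a : nat -> R) n :
  runmax a n ^+ 2 <= 2 * runmax a n * a n - 2 * \sum_(i < n) runmax a i * (a i.+1 - a i).
Proof.
elim: n => [|n IH]; first by rewrite big_ord0 mulr0 subr0 /=; have := sqr_ge0 (a 0); nra.
rewrite big_ord_recr /=; move: IH; set m := runmax a n; set S := \sum_(i < n) _ => IH.
rewrite /Num.max; case: ltP => h; last by nra.
have := sqr_ge0 (a n.+1 - m); nra.
Qed.

(** Taken in the order D N, ..., D 0, the conditional expectations of [g] form a
    martingale, and their running maximum up to D i is invariant under the subsets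
    of D i. *)
Lemma doob_chain (D : nat -> {set T}) N g :
  (forall i, D i \subset D i.+1) ->
  exists2 M : {set T} -> R, (forall i A, (i <= N)%N -> conv (unif (D i)) g A <= M A) &
    \sum_A M A ^+ 2 <= 4 * \sum_A g A ^+ 2.
Proof.
move=> Dm; have Dle i j : (i <= j)%N -> D i \subset D j.
  elim: j => [|j IH]; first by rewrite leqn0 => /eqP->.
  rewrite leq_eqVlt ltnS => /orP[/eqP->//|/IH h]; exact: (subset_trans h (Dm j)).
pose a A i := conv (unif (D (N - i)%N)) g A.
exists (fun A => runmax (a A) N) => [i A iN|].
  by have := @runmax_ge (a A) N (N - i)%N (leq_subr _ _); rewrite /a subKn.
have inv n A K : K \subset D (N - n)%N -> runmax (a (symd A K)) n = runmax (a A) n.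
  move=> KD; have aE i : (i <= n)%N -> a (symd A K) i = a A i.
    by move=> ?; apply: conv_unif_inv; apply: (subset_trans KD); apply: Dle; lia.
  elim: n KD aE => [|n IH] KD aE /=; first exact: aE.
  rewrite IH ?aE// => [|i ?]; last by apply: aE; lia.
  by apply: (subset_trans KD); apply: Dle; lia.
have E n i : (i <= n)%N -> \sum_A runmax (a A) i * a A n = \sum_A runmax (a A) i * g A.
  move=> i_n; apply: sum_conv_unif => A K KD; apply: inv.
  by apply: (subset_trans KD); apply: Dle; lia.
have H : \sum_A runmax (a A) N ^+ 2 <= 2 * \sum_A runmax (a A) N * g A.
  apply: (@le_trans _ _ (\sum_A (2 * (runmax (a A) N * a A N)
        - 2 * \sum_(i < N) runmax (a A) i * (a A i.+1 - a A i)))).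
    by apply: ler_sum => A _; rewrite mulrA; exact: runmax_doob.
  rewrite sumrB -!mulr_sumr E// exchange_big /= [X in _ - 2 * X]big1 ?mulr0 ?subr0// => i _.
  under eq_bigr do rewrite mulrBr.
  by rewrite sumrB !E// subrr.
have H2 : 2 * \sum_A runmax (a A) N * g A <= 2^-1 * \sum_A runmax (a A) N ^+ 2 + 2 * \sum_A g A ^+ 2.
  rewrite !mulr_sumr -big_split /=; apply: ler_sum => A _.
  have := sqr_ge0 (runmax (a A) N - 2 * g A); nra.
lra.
Qed.

Section Labels.
Variables (B : {set T}) (n : nat).
Implicit Type f : {ffun T -> 'I_n}.

Definition below f (k : nat) : {set T} := [set j in B | (f j < k)%N].
Definition label_weight : R := n%:R ^- #|T|.

(** A mean, over uniform labellings [f] of the coordinates, of conditional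
    expectations: each coordinate of [B] is re-randomised independently with
    probability k / n, and for a fixed [f] the re-randomised sets increase with
    k, as [doob_chain] requires. *)
Definition noise k K : R := \sum_f label_weight * unif (below f k) K.

(** Multiplying the density by [walsh B] moves the multiplier from X to
    [symd X B], which exchanges the numbers of minus and plus signs in [B]. *)
Definition symnoise k K : R := noise k K + (-1) ^+ k * (walsh B K * noise k K).

Lemma label_weight_ge0 : 0 <= label_weight.
Proof. by rewrite invr_ge0 exprn_ge0. Qed.

Lemma sum_label_weight : (0 < n)%N -> \sum_(f : {ffun T -> 'I_n}) label_weight = 1.
Proof.
move=> n0; rewrite sumr_const card_ffun card_ord -mulr_natl natrX mulfV//.
by rewrite expf_neq0// pnatr_eq0 -lt0n.
Qed.

Lemma ft_noise k X : (0 < n)%N -> (k <= n)%N ->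
  ft (noise k) X = (1 - k%:R / n%:R) ^+ #|B :&: X|.
Proof.
move=> n0 kn; have nR : n%:R != 0 :> R by rewrite pnatr_eq0 -lt0n.
rewrite /ft; under eq_bigr do rewrite mulr_sumr.
rewrite exchange_big /=.
transitivity (label_weight * \sum_f ft (unif (below f k)) X).
  rewrite mulr_sumr; apply: eq_bigr => f _; rewrite mulr_sumr; apply: eq_bigr => A _.
  by rewrite mulrCA.
have -> : \sum_(f : {ffun T -> 'I_n}) ft (unif (below f k)) X =
   \sum_(f : {ffun T -> 'I_n}) \prod_j (if j \in B :&: X then (k <= f j)%N%:R else 1).
  apply: eq_bigr => f _; rewrite ft_unif.
  have [/pred0P dj|/pred0Pn[j /andP[/= jX]]] := boolP [disjoint X & below f k].
    rewrite big1// => j _; case: ifP => //; rewrite inE => /andP[jB jX].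
    by have := dj j; rewrite /= jX inE jB /= ltnNge => /negbFE ->.
  by rewrite inE => /andP[jB fj]; rewrite (bigD1 j)//= inE jB jX leqNgt fj mul0r.
rewrite -(bigA_distr_bigA (fun j (i : 'I_n) => if j \in B :&: X then (k <= i)%N%:R else 1)) /=.
have S j : \sum_(i < n) (if j \in B :&: X then (k <= i)%N%:R else 1 : R) =
    n%:R * (if j \in B :&: X then 1 - k%:R / n%:R else 1).
  case: ifP => _; last by rewrite mulr1 sumr_const card_ord.
  rewrite mulrBr mulr1 mulrCA mulfV// mulr1 -natrB// -natr_sum; congr (_%:R).
  rewrite -(big_mkord xpredT (fun i => nat_of_bool (k <= i)%N)) (big_cat_nat (n := k))//=.
  rewrite big_nat_cond big1 => [|i /andP[/andP[_ ik] _]]; last by rewrite leqNgt ik.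
  rewrite add0n big_nat_cond (eq_bigr (fun=> 1%N)) => [|i /andP[/andP[-> _] _]//].
  by rewrite -big_nat_cond sum_nat_const_nat muln1.
rewrite (eq_bigr _ (fun j _ => S j)) big_split /= prodr_const.
rewrite mulrA /label_weight mulVf ?expf_neq0// mul1r -big_mkcond /=.
by rewrite prodr_const.
Qed.

Lemma ft_symnoise k X : (0 < n)%N -> (k <= n)%N -> #|B| = n ->
  ft (symnoise k) X = symnoise_mult R k #|B :&: X| #|B :\: X|.
Proof.
move=> n0 kn Bn; rewrite /symnoise_mult cardsID Bn -ft_noise//.
transitivity (ft (noise k) X + (-1) ^+ k * ft (noise k) (symd X B)).
  rewrite /ft mulr_sumr -big_split /=; apply: eq_bigr => A _.
  by rewrite /symnoise [walsh (symd X B) A]walshC walshD (walshC A X) (walshC A B); ring.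
rewrite !ft_noise//; congr (_ + _ * _ ^+ _); apply: eq_card => j.
by rewrite !inE; do 2 case: (_ \in _).
Qed.

Lemma conv_symnoise_le k g A : `|conv (symnoise k) g A| <=
  2 * \sum_f label_weight * conv (unif (below f k)) (fun A => `|g A|) A.
Proof.
have c0 D K : 0 <= unif D K by rewrite divr_ge0// exprn_ge0.
have N0 K : 0 <= noise k K by apply: sumr_ge0 => f _; rewrite mulr_ge0// label_weight_ge0.
apply: (@le_trans _ _ (2 * \sum_K noise k K * `|g (symd A K)|)).
  rewrite mulr_sumr (le_trans (ler_norm_sum _ _ _))//; apply: ler_sum => K _.
  rewrite normrM mulrA ler_wpM2r// /symnoise (le_trans (ler_normD _ _))//.
  by rewrite !normrM normrX normrN1 expr1n mul1r walsh_norm mul1r ger0_norm//; lra.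
rewrite ler_wpM2l//.
have -> : \sum_K noise k K * `|g (symd A K)| =
  \sum_f label_weight * conv (unif (below f k)) (fun A => `|g A|) A; last by [].
under eq_bigr do rewrite /noise mulr_suml.
rewrite exchange_big; apply: eq_bigr => f _ /=.
by rewrite mulr_sumr; apply: eq_bigr => K _; rewrite mulrA.
Qed.

(** The bound of [doob_chain] holds for each labelling and is preserved by the
    mean over labellings. *)
Lemma symnoise_max g : (0 < n)%N -> exists2 M : {set T} -> R,
  (forall k A, (k <= n)%N -> conv (symnoise k) g A ^+ 2 <= M A) &
  \sum_A M A <= 16 * \sum_A g A ^+ 2.
Proof.
move=> n0.
have H f : exists M : {set T} -> R, (forall i A, (i <= n)%N ->
      conv (unif (below f i)) (fun A => `|g A|) A <= M A) /\
    \sum_A M A ^+ 2 <= 4 * \sum_A g A ^+ 2.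
  have Dm i : below f i \subset below f i.+1.
    by apply/subsetP => j; rewrite !inE => /andP[-> /ltnW].
  have [M h1 h2] := doob_chain n (fun A => `|g A|) Dm.
  exists M; split=> //; apply: (le_trans h2); rewrite ler_wpM2l// ler_sum// => A _.
  by rewrite real_normK ?num_real.
have [M HM] := choice H.
exists (fun A => 4 * \sum_f label_weight * M f A ^+ 2) => [k A kn|].
  rewrite -real_normK ?num_real//.
  apply: (@le_trans _ _ ((2 * \sum_f label_weight * M f A) ^+ 2)).
    rewrite lerXn2r// ?nnegrE//.
      apply: (le_trans (normr_ge0 _) _) => //; last first.
        apply: (le_trans (conv_symnoise_le k g A)).
        by rewrite ler_wpM2l// ler_sum// => f _; rewrite ler_wpM2l ?label_weight_ge0//; apply: (HM f).1.
    apply: (le_trans (conv_symnoise_le k g A)).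
    by rewrite ler_wpM2l// ler_sum// => f _; rewrite ler_wpM2l ?label_weight_ge0//; apply: (HM f).1.
  rewrite exprMn (_ : 2 ^+ 2 = 4); last by ring.
  rewrite ler_wpM2l//; apply: (le_trans (@sqr_wsum_le _ _ _ (fun=> label_weight) _ _)); first by move=> ?; exact: label_weight_ge0.
  by rewrite sum_label_weight// mul1r.
rewrite -mulr_sumr exchange_big /=.
apply: (@le_trans _ _ (4 * \sum_(f : {ffun T -> 'I_n}) label_weight * (4 * \sum_A g A ^+ 2))).
  rewrite ler_wpM2l// ler_sum// => f _; rewrite -mulr_sumr ler_wpM2l ?label_weight_ge0//.
  exact: (HM f).2.
by rewrite -mulr_suml sum_label_weight// mul1r; lra.
Qed.

End Labels.

(** 16 is the constant of [symnoise_max]; 872 and 16^2 * 27 bound the two square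
    functions, once for each parity; 3 comes from [abel_sqr_le]. *)
Definition slice_const : R := 3 * (16 + 2 * 872 + 2 * (16 ^+ 2 * 27)).

(** The dimension-free maximal inequality for one family of slices.  The parity of
    k is fixed first, since only increments of step two are small, and the two
    parities are added up in the majorant. *)
Lemma slice_max B g : exists2 W : {set T} -> R,
  (forall k A, (8 * k + 16 <= #|B|)%N -> conv (slice B k) g A ^+ 2 <= W A) &
  \sum_A W A <= slice_const * \sum_A g A ^+ 2.
Proof.
have G0 : 0 <= \sum_A g A ^+ 2 by apply: sumr_ge0 => A _; rewrite sqr_ge0.
have C0 : 0 <= slice_const by rewrite /slice_const; lra.
have [nB|nB] := ltnP #|B| 16.
  exists (fun=> 0) => [k A|]; first by rewrite leqNgt => /negP[]; move: nB; clear; lia.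
  by rewrite big1// mulr_ge0.
set n := #|B| in nB *; have n0 : (0 < n)%N by apply: leq_trans nB.
have [M HM SM] := symnoise_max B g n0.
(* The largest L for which [kraw_diff_sum] with L terms and [kraw_symnoise_sum] with
   L + 1 terms apply to both parities. *)
pose L := ((n - 6) %/ 8)%N.
pose b e A l := conv (slice B (e + l.*2)%N) g A.
pose r e A l := conv (symnoise B n (e + l.*2)%N) g A.
pose Q2 e A := \sum_(l < L.+1) (b e A l - r e A l) ^+ 2 / l.+1%:R.
pose Q1 e A := \sum_(l < L) l.+1%:R * (b e A l - b e A l.+1) ^+ 2.
have convB (p q : {set T} -> R) A : conv (fun K => p K - q K) g A = conv p g A - conv q g A.
  by rewrite /conv -sumrB; apply: eq_bigr => K _; rewrite mulrBl.
have ftB (p q : {set T} -> R) X : ft (fun K => p K - q K) X = ft p X - ft q X.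
  by rewrite /ft -sumrB; apply: eq_bigr => K _; rewrite mulrBr.
have L8 : (8 * L + 6 <= n)%N by rewrite /L; move: nB; clear; lia.
have SQ1 e : (e <= 1)%N -> \sum_A Q1 e A <= (16 ^+ 2 * 27) * \sum_A g A ^+ 2.
  move=> e1.
  rewrite (eq_bigr (fun A => \sum_(l < L) l.+1%:R *
    conv (fun K => slice B (e + l.*2)%N K - slice B (e + l.+1.*2)%N K) g A ^+ 2)); last first.
    by move=> A _; apply: eq_bigr => l _; rewrite convB.
  apply: (@sum_conv_le _ (fun l : 'I_L => l.+1%:R)) => X.
  under eq_bigr do rewrite ftB !ft_slice doubleS !addnS.
  by apply: kraw_diff_sum => //; rewrite cardsID -/n; move: L8 e1; clear; lia.
have SQ2 e : (e <= 1)%N -> \sum_A Q2 e A <= 872 * \sum_A g A ^+ 2.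
  move=> e1.
  rewrite (eq_bigr (fun A => \sum_(l < L.+1) l.+1%:R^-1 *
    conv (fun K => slice B (e + l.*2)%N K - symnoise B n (e + l.*2)%N K) g A ^+ 2)); last first.
    by move=> A _; apply: eq_bigr => l _; rewrite convB mulrC.
  apply: (@sum_conv_le _ (fun l : 'I_L.+1 => l.+1%:R^-1)) => X.
  rewrite (eq_bigr (fun l : 'I_L.+1 => (kraw R (e + l.*2)%N #|B :&: X| #|B :\: X| -
     symnoise_mult R (e + l.*2)%N #|B :&: X| #|B :\: X|) ^+ 2 / l.+1%:R)).
    by apply: kraw_symnoise_sum => //; rewrite cardsID -/n; move: L8 e1; clear; lia.
  move=> l _; rewrite ftB ft_slice ft_symnoise// 1?mulrC//.
  by have := ltn_ord l; move: L8 e1; clear; lia.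
have Q10 e A : 0 <= Q1 e A by apply: sumr_ge0 => l _; rewrite mulr_ge0 ?sqr_ge0.
have Q20 e A : 0 <= Q2 e A by apply: sumr_ge0 => l _; rewrite divr_ge0 ?sqr_ge0.
exists (fun A => 3 * (M A + (Q2 0%N A + Q2 1%N A) + (Q1 0%N A + Q1 1%N A))) => [k A kn|].
  pose e := nat_of_bool (odd k); pose l := k./2.
  have kE : k = (e + l.*2)%N by rewrite odd_double_half.
  have e1 : (e <= 1)%N by rewrite /e; case: (odd k).
  have lL : (l <= L)%N by move: kn; rewrite kE /L; clear; lia.
  have := @abel_sqr_le R (b e A) (r e A) (M A) l.
  rewrite {1}/b -kE => h; apply: (le_trans (h _)) => [i il|].
    by apply: HM; move: il lL L8 e1; clear; lia.
  rewrite ler_wpM2l//.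
  have Q2l : \sum_(i < l.+1) (b e A i - r e A i) ^+ 2 / i.+1%:R <= Q2 e A.
    rewrite /Q2 -(subnKC lL) -addSn big_split_ord /= lerDl.
    by apply: sumr_ge0 => i _; rewrite divr_ge0 ?sqr_ge0.
  have Q1l : \sum_(i < l) i.+1%:R * (b e A i - b e A i.+1) ^+ 2 <= Q1 e A.
    rewrite /Q1 -(subnKC lL) big_split_ord /= lerDl.
    by apply: sumr_ge0 => i _; rewrite mulr_ge0 ?sqr_ge0.
  have Q2e : Q2 e A <= Q2 0%N A + Q2 1%N A by rewrite /e; case: (odd k); rewrite ?lerDr ?lerDl.
  have Q1e : Q1 e A <= Q1 0%N A + Q1 1%N A by rewrite /e; case: (odd k); rewrite ?lerDr ?lerDl.
  by rewrite !lerD// ?(le_trans Q2l)// (le_trans Q1l).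
rewrite -mulr_sumr !big_split /= /slice_const -mulrA ler_wpM2l//.
have := SQ1 0%N isT; have := SQ1 1%N isT; have := SQ2 0%N isT; have := SQ2 1%N isT; lra.
Qed.

End Cube.

(** * Several colour classes *)

Section Multi.
Import fintype finset.
Variables (R : realType) (T : finType).
Implicit Types (A B D K X : {set T}) (g h : {set T} -> R).

Lemma slice_maximal B g : exists2 V : {set T} -> R,
  (forall k A, (8 * k + 16 <= #|B|)%N -> conv (slice R B k) g A <= V A) &
  \sum_A V A ^+ 2 <= slice_const R * \sum_A g A ^+ 2.
Proof.
have [W HW SW] := slice_max B g.
have [nB|nB] := ltnP #|B| 16.
  exists (fun=> 0) => [k A|]; first by rewrite leqNgt => /negP[]; move: nB; clear; lia.
  rewrite big1 => [|A _]; last by rewrite expr0n.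
  by rewrite mulr_ge0// ?sumr_ge0// /slice_const; [lra|move=> A _; exact: sqr_ge0].
have W0 A : 0 <= W A.
  by apply: le_trans (HW 0%N A _); [exact: sqr_ge0|rewrite muln0].
exists (fun A => Num.sqrt (W A)) => [k A kn|]; last first.
  by under eq_bigr do rewrite sqr_sqrtr//.
by rewrite (le_trans (ler_norm _))// -sqrtr_sqr ler_wsqrtr// HW.
Qed.

Lemma slice_ge0 B k K : 0 <= slice R B k K.
Proof. by rewrite divr_ge0. Qed.

Lemma sum_slice B k : (k <= #|B|)%N -> \sum_K slice R B k K = 1.
Proof.
move=> kB; rewrite -mulr_suml (_ : \sum_K _ = 'C(#|B|, k)%:R) ?mulfV//.
  by rewrite pnatr_eq0 -lt0n bin_gt0.
rewrite -cards_draws -sum1_card natr_sum [RHS]big_mkcond /=.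
by apply: eq_bigr => K _; rewrite inE; case: ifP.
Qed.

Lemma conv_mono (phi g h : {set T} -> R) A : (forall K, 0 <= phi K) ->
  (forall K, g K <= h K) -> conv phi g A <= conv phi h A.
Proof. by move=> p0 gh; apply: ler_sum => K _; rewrite ler_wpM2l. Qed.

Variables (m : nat) (c : T -> 'I_m).
Definition colour i : {set T} := [set j | c j == i].

Fixpoint slices (s : seq 'I_m) (a : 'I_m -> nat) (g : {set T} -> R) : {set T} -> R :=
  if s is i :: s' then conv (slice R (colour i) (a i)) (slices s' a g) else g.

Lemma slices_ge0 s a g A : (forall K, 0 <= g K) -> 0 <= slices s a g A.
Proof.
move=> g0; elim: s A => [|i s IH] A //=.
by apply: sumr_ge0 => K _; rewrite mulr_ge0// slice_ge0.
Qed.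

Lemma slices_shift s a g A B :
  slices s a (fun K => g (symd A K)) B = slices s a g (symd A B).
Proof.
elim: s B => [|i s IH] B //=; apply: eq_bigr => K _.
by rewrite IH symdA.
Qed.

Lemma slices_sum (I : finType) (w : I -> R) s a (g : I -> {set T} -> R) A :
  \sum_i w i * slices s a (g i) A = slices s a (fun K => \sum_i w i * g i K) A.
Proof.
elim: s A => [|i s IH] A //=.
rewrite /conv; under [RHS]eq_bigr do rewrite -IH mulr_sumr.
rewrite exchange_big; apply: eq_bigr => k _ /=.
by rewrite mulr_sumr; apply: eq_bigr => K _; rewrite mulrCA.
Qed.

(** Since the colour classes are disjoint, successive slices involve only sets
    with the prescribed number of elements of each colour. *)
Lemma slices_const s a g A (v : R) : uniq s ->
  (forall i, i \in s -> (a i <= #|colour i|)%N) ->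
  (forall K, K \subset [set j | c j \in s] ->
     (forall i, i \in s -> #|K :&: colour i| = a i) -> g (symd A K) = v) ->
  slices s a g A = v.
Proof.
elim: s A => [|i s IH] A /= => [_ _ H|/andP[is_ us] aB H].
  rewrite -(H (finset.set0)) ?finset.sub0set//; congr g.
  by apply/setP => j; rewrite !inE addbF.
rewrite -[RHS]mul1r -(@sum_slice (colour i) (a i)) ?aB ?mem_head// mulr_suml.
rewrite /conv; apply: eq_bigr => K _; rewrite /slice.
case: (boolP (_ && _)) => [/andP[/subsetP KB /eqP Ka]|_]; last by rewrite !mul0r.
congr (_ * _); apply: IH => // [l ls|K' /subsetP K's K'a].
  by apply: aB; rewrite inE ls orbT.
have KB' j : j \in K -> c j = i by move=> /KB; rewrite inE => /eqP.
have Ks' j : j \in K' -> c j \in s by move=> /K's; rewrite inE.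
rewrite -symdA; apply: H => [|l].
  apply/subsetP => j; rewrite !inE.
  have := KB' j; have := Ks' j.
  case: (j \in K) => [_ /(_ isT) ->|]; first by rewrite eqxx.
  by case: (j \in K') => // /(_ isT) -> _ _; rewrite orbT.
rewrite inE => /orP[/eqP->|ls].
  rewrite -Ka; apply: eq_card => j; rewrite !inE.
  have := KB' j; have := Ks' j.
  case: (j \in K') => [/(_ isT) cs _|_]; last first.
    by rewrite addbF; case: (j \in K) => // /(_ isT) ->; rewrite eqxx.
  have ci : c j != i by apply: contraNneq is_ => <-.
  rewrite (negbTE ci) andbF; case: (boolP (j \in K)) => // /KB'/eqP.
  by rewrite (negbTE ci).
rewrite -K'a//; apply: eq_card => j; rewrite !inE.
have [cl|] := eqVneq (c j) l; last by rewrite !andbF.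
have -> : j \in K = false; last by rewrite addFb.
by apply/negP => /KB' ci; move: is_; rewrite -ci cl ls.
Qed.

(** One application of [slice_maximal] for each colour, to the majorant found for
    the previous colours. *)
Lemma slices_maximal s g : (forall K, 0 <= g K) -> exists2 V : {set T} -> R,
  (forall a A, (forall i, i \in s -> (8 * a i + 16 <= #|colour i|)%N) -> slices s a g A <= V A) &
  \sum_A V A ^+ 2 <= slice_const R ^+ size s * \sum_A g A ^+ 2.
Proof.
move=> g0; elim: s => [|i s [V HV SV]] /=.
  by exists g => //; rewrite expr0 mul1r.
have [W HW SW] := slice_maximal (colour i) V.
exists W => [a A ha|].
  apply: le_trans (HW (a i) A _); last by apply: ha; rewrite mem_head.
  apply: conv_mono => [K|K]; first exact: slice_ge0.
  by apply: HV => l ls; apply: ha; rewrite inE ls orbT.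
apply: (le_trans SW); rewrite exprS -mulrA ler_wpM2l//.
by rewrite /slice_const; lra.
Qed.

Variable N : nat.

(** An explicit maximum, contrary to the majorants obtained above, commutes with
    the translations of the hypercube. *)
Definition slices_max (g : {set T} -> R) A : R :=
  \big[Num.max/0]_(a : {ffun 'I_m -> 'I_N.+1}) slices (enum 'I_m) (fun i => a i) g A.

Lemma slices_max_ge0 g A : 0 <= slices_max g A.
Proof. by rewrite /slices_max bigmax_ge_id. Qed.

Lemma slices_max_shift g A : slices_max (fun K => g (symd A K)) finset.set0 = slices_max g A.
Proof.
apply: eq_bigr => a _; rewrite slices_shift; congr slices.
by apply/setP => j; rewrite !inE addbF.
Qed.

Lemma slices_max_ge (a : 'I_m -> nat) g A : (forall i, (a i <= N)%N) ->
  slices (enum 'I_m) a g A <= slices_max g A.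
Proof.
move=> aN; pose b := [ffun i => inord (a i) : 'I_N.+1].
have -> : slices (enum 'I_m) a g A = slices (enum 'I_m) (fun i => b i) g A.
  have ab i : a i = b i by rewrite ffunE inordK// ltnS.
  by elim: (enum _) A => [|i s IH] A //=; rewrite ab; apply: eq_bigr => K _; rewrite IH.
exact: (le_bigmax_cond _ (fun a : {ffun 'I_m -> 'I_N.+1} => slices (enum 'I_m) (fun i => a i) g A)).
Qed.

Lemma slices_max_l2 g : (forall K, 0 <= g K) -> (forall i, (8 * N + 16 <= #|colour i|)%N) ->
  \sum_A slices_max g A ^+ 2 <= slice_const R ^+ m * \sum_A g A ^+ 2.
Proof.
move=> g0 hN; have [V HV SV] := slices_maximal (enum 'I_m) g0.
rewrite size_enum_ord in SV; apply: le_trans SV; apply: ler_sum => A _.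
have HV' (a : {ffun 'I_m -> 'I_N.+1}) : slices (enum 'I_m) (fun i => a i) g A <= V A.
  by apply: HV => i _; apply: leq_trans (hN i); have := ltn_ord (a i); lia.
have V0 : 0 <= V A by apply: le_trans (HV' [ffun=> ord0]); exact: slices_ge0.
by rewrite lerXn2r ?nnegrE ?slices_max_ge0//; apply: bigmax_le.
Qed.

End Multi.

(** * Commuting involutions and signed permutations *)

Section Flip.
Implicit Types (z : int) (s : nat) (b : bool).

Definition block_parity z s : bool := odd `|(z %/ s)%Z|%N.

(** The blocks of the s consecutive integers from q s to (q+1) s - 1 are matched
    into consecutive pairs, in one of two ways according to [b], and [z] is moved
    to the corresponding point of the partner of its block.  A translation by s or
    -s thus becomes an involution. *)
Definition flip z s b : int := z - (-1) ^+ (b (+) block_parity z s) * s%:Z.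

Lemma block_parity_add z s b : (0 < s)%N -> block_parity (z - (-1) ^+ b * s%:Z) s = ~~ block_parity z s.
Proof.
move=> s0; have s0' : s%:Z != 0 by lia.
rewrite /block_parity -mulNr addrC divzMDl//; case: b; rewrite ?expr0 ?expr1; lia.
Qed.

Lemma flipK s b : (0 < s)%N -> involutive (flip^~ s ^~ b).
Proof.
move=> s0 z; rewrite /flip block_parity_add// addbN; case: (b (+) _); rewrite ?expr0 ?expr1; lia.
Qed.
End Flip.

Section Signed.
Import fintype finset.
Variables (d m : nat) (c : 'I_d -> 'I_m).
Local Notation L := (lattice d).
Definition sgnperm := ({perm 'I_d} * {ffun 'I_d -> bool})%type.
Implicit Types (w : sgnperm) (x y : L) (A B K : {set 'I_d}).

Definition act w y : L := \row_j ((-1) ^+ (w.2 j) * y ord0 (w.1 j)).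

(** The coordinates whose image under the permutation lies in [A] are moved by
    the step attached to their colour. *)
Definition toggle w A x : L :=
  \row_j (if w.1 j \in A then flip (x ord0 j) (c (w.1 j)).+1 (w.2 j) else x ord0 j).
Definition pattern K : L := \row_j (if j \in K then (c j).+1%:Z else 0).

Lemma toggle_symd w A B x : toggle w (symd A B) x = toggle w A (toggle w B x).
Proof.
apply/rowP => j; rewrite !mxE !inE.
by case: (w.1 j \in A); case: (w.1 j \in B) => //=; rewrite flipK.
Qed.

Lemma toggle0 w x : toggle w finset.set0 x = x.
Proof. by apply/rowP => j; rewrite !mxE inE. Qed.

Lemma toggleK w A : involutive (toggle w A).
Proof.
move=> x; rewrite -toggle_symd -[RHS](toggle0 w); congr toggle.
by apply/setP => j; rewrite !inE addbb.
Qed.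

Variable R : realType.
Implicit Type u : L -> R.

(** For a given [x] and a given permutation, the parities of the blocks only twist
    the signs of [w] by a fixed vector, so they disappear from the sum over all
    signs. *)
Lemma sum_toggle u A x :
  \sum_w u (toggle w A x) = \sum_w u (x - act w (pattern A)).
Proof.
(* Twisting the signs by the block parities of x permutes the signed permutations. *)
pose h w : sgnperm := (w.1, [ffun j => w.2 j (+) block_parity (x ord0 j) (c (w.1 j)).+1]).
rewrite [RHS](reindex_inj (h := h)) /=.
  apply: eq_bigr => w _; congr u; apply/rowP => j; rewrite !mxE /= ffunE.
  by case: (_ \in A); rewrite ?mulr0 ?subr0.
move=> [p s] [p' s'] [<- /ffunP ss]; congr (_, _); apply/ffunP => j.
by have := ss j; rewrite !ffunE; apply: addIb.
Qed.

Definition orbsum u x y := \sum_w u (x - act w y).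

Lemma orbsum_act u x w0 y : orbsum u x (act w0 y) = orbsum u x y.
Proof.
pose h w : sgnperm := ((w.1 * w0.1)%g, [ffun j => w.2 j (+) w0.2 (w.1 j)]).
rewrite /orbsum [RHS](reindex_inj (h := h)) /=.
  apply: eq_bigr => w _; congr (u (_ - _)); apply/rowP => j; rewrite !mxE /= ffunE permM.
  by rewrite signr_addb mulrA.
move=> [p s] [p' s'] [/= /mulIg <- /ffunP ss]; congr (_, _); apply/ffunP => j.
by have := ss j; rewrite !ffunE; apply: addIb.
Qed.

Definition multiplicity y i : nat := #|[set j | `|y ord0 j|%N == i]|.
Definition small_coords y := [forall j, (`|y ord0 j| <= m)%N].

Lemma sum_multiplicity y : small_coords y -> (\sum_(i < m.+1) multiplicity y i)%N = d.
Proof.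
move=> /forallP ym; rewrite -[RHS]card_ord -sum1_card.
rewrite (partition_big (fun j => inord `|y ord0 j|%N : 'I_m.+1) xpredT)//=.
apply: eq_bigr => i _; rewrite /multiplicity -sum1_card; apply: eq_bigl => j.
by rewrite inE -val_eqE /= inordK// ltnS.
Qed.

(** The number of zero coordinates is determined by the other multiplicities, so
    the two vectors of absolute values are permutations of each other. *)
Lemma act_transitive y y' : small_coords y -> small_coords y' ->
  (forall i : 'I_m, multiplicity y i.+1 = multiplicity y' i.+1) -> exists w, y' = act w y.
Proof.
move=> ym ym' E.
have E' i : multiplicity y i = multiplicity y' i.
  case: i => [|i].
    have := sum_multiplicity ym; have := sum_multiplicity ym'; rewrite !big_ord_recl /=.
    rewrite (eq_bigr (fun i : 'I_m => multiplicity y' i.+1)) => [|i _]; last first.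
      by rewrite /bump leq0n add1n.
    rewrite [X in _ -> (_ + X)%N = _ -> _](eq_bigr (fun i : 'I_m => multiplicity y' i.+1)); last first.
      by move=> i _; rewrite /bump leq0n add1n E.
    by lia.
  have [im|im] := ltnP i m; first exact: (E (Ordinal im)).
  have Z z : small_coords z -> multiplicity z i.+1 = 0%N.
    move=> /forallP zm; apply: eq_card0 => j; rewrite inE; apply/negP => /eqP zi.
    by have := zm j; rewrite zi ltnNge im.
  by rewrite !Z.
pose t (z : L) := [tuple `|z ord0 j|%N | j < d].
have /tuple_permP[p tp] : perm_eq (t y') (t y).
  rewrite /perm_eq; apply/allP => v _ /=; apply/eqP.
  have C z : count_mem v (t z) = multiplicity z v.
    rewrite /multiplicity cardsE cardE /t /= count_map -size_filter enumT.
    by congr size; apply: eq_filter => j; rewrite inE.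
  by rewrite !C E'.
have tpj j : `|y' ord0 j|%N = `|y ord0 (p j)|%N.
  have := congr1 (fun s => nth 0%N s j) tp.
  by rewrite -!tnth_nth !tnth_mktuple.
exists (p, [ffun j => y' ord0 j != y ord0 (p j)]); apply/rowP => j.
rewrite !mxE /= ffunE; have := tpj j; case: eqVneq => [->|]; first by rewrite expr0 mul1r.
move: (y' ord0 j) (y ord0 (p j)) => a b; rewrite expr1; lia.
Qed.

Lemma small_coords_pattern K : small_coords (pattern K).
Proof. by apply/forallP => j; rewrite mxE; case: ifP => _ //; exact: ltn_ord. Qed.

Lemma multiplicity_pattern K (i : 'I_m) : multiplicity (pattern K) i.+1 = #|K :&: colour c i|.
Proof.
apply: eq_card => j; rewrite !inE mxE; case: (j \in K) => //=.
Qed.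

(** The link between the lattice and the hypercube: every set [K] selected by the
    slices gives a vector [pattern K] in the orbit of [y], and sums over an orbit do
    not depend on the chosen representative. *)
Lemma slices_orbsum u x y : small_coords y ->
  (forall i : 'I_m, (multiplicity y i.+1 <= #|colour c i|)%N) ->
  \sum_w slices c (enum 'I_m) (fun i => multiplicity y i.+1) (fun K => u (toggle w K x)) finset.set0
  = orbsum u x y.
Proof.
move=> ym yc.
under eq_bigr do rewrite -[slices _ _ _ _ _]mul1r.
rewrite (slices_sum c (fun=> 1)); apply: slices_const; first exact: enum_uniq.
  by move=> i _.
move=> K _ Ka; under eq_bigr do rewrite mul1r.
rewrite sum_toggle -/(orbsum u x _).
have -> : symd finset.set0 K = K by apply/setP => j; rewrite !inE.
have [i|w ->] := act_transitive ym (small_coords_pattern K); last by rewrite orbsum_act.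
by rewrite multiplicity_pattern Ka// mem_enum.
Qed.

End Signed.

(** * Lattice points in balls *)

Section Counting.

Lemma count_inj_le (T T' : eqType) (s : seq T) (s' : seq T') (P : pred T) (Q : pred T') (f : T -> T') :
  uniq s -> {in s &, forall x y, P x -> P y -> f x = f y -> x = y} ->
  {in s, forall x, P x -> (f x \in s') && Q (f x)} -> (count P s <= count Q s')%N.
Proof.
move=> us fI fs; rewrite -!size_filter -(size_map f); apply: uniq_leq_size.
  rewrite map_inj_in_uniq ?filter_uniq// => x y; rewrite !mem_filter => /andP[Px xs] /andP[Py ys].
  exact: fI.
move=> z /mapP[x]; rewrite mem_filter => /andP[Px xs] ->.
by rewrite mem_filter andbC fs.
Qed.

Lemma sum_bool_count (T : Type) (s : seq T) (P : pred T) : (\sum_(x <- s) P x = count P s)%N.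
Proof. by rewrite -sum1_count [RHS]big_mkcond; apply: eq_bigr => x _; case: (P x). Qed.

Lemma sum_const_seq (T : Type) (s : seq T) k : (\sum_(x <- s) k = k * size s)%N.
Proof. by rewrite big_const_seq count_predT iter_addn_0. Qed.
End Counting.

Section Balls.
Import fintype finset.
Variable d : nat.
Local Notation L := (lattice d).
Implicit Types (x y : L) (n : nat).

Definition normsq y : nat := (\sum_j `|y ord0 j| ^ 2)%N.

Lemma lattice_ballE (R : realType) (t : R) :
  lattice_ball d t = [set y : L | (normsq y <= Num.truncn (t ^+ 2))%N]%classic.
Proof.
have E (y : L) : \sum_j ((y ord0 j)%:~R : R) ^+ 2 = (normsq y)%:R.
  rewrite /normsq natr_sum; apply: eq_bigr => j _.
  by rewrite natrX natr_absz intr_norm real_normK ?num_real.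
by apply/seteqP; split=> y; rewrite /lattice_ball /= E truncn_ge_nat// sqr_ge0.
Qed.

Lemma absz_normsq y j : (`|y ord0 j| ^ 2 <= normsq y)%N.
Proof. by rewrite /normsq (bigD1 j)//= leq_addr. Qed.

Lemma absz_le_normsq y j : (`|y ord0 j| <= normsq y)%N.
Proof. by apply: leq_trans (absz_normsq y j); move: `|_|%N => k; nia. Qed.

Lemma finite_normsq n : finite_set [set y : L | (normsq y <= n)%N]%classic.
Proof.
pose g (k : {ffun 'I_d -> 'I_n.*2.+1}) : L := \row_j ((k j)%:Z - n%:Z).
apply: (@sub_finite_set _ _ (g @` setT)%classic); last exact/finite_image/finite_finset.
move=> y /= yn; have yj j : (`|y ord0 j| <= n)%N by apply: leq_trans yn; exact: absz_le_normsq.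
exists [ffun j => inord `|(y ord0 j + n%:Z)%R|%N] => //; apply/rowP => j.
rewrite mxE ffunE inordK; have := yj j; move: (y ord0 j) => k; lia.
Qed.

Definition ball n : seq L := enum_fset (fset_set [set y : L | (normsq y <= n)%N]%classic).

Lemma ball_uniq n : uniq (ball n).
Proof. exact: fset_uniq. Qed.

Lemma mem_ball n y : (y \in ball n) = (normsq y <= n)%N.
Proof.
rewrite [LHS](_ : _ = (y \in fset_set [set y : L | (normsq y <= n)%N]%classic))//.
rewrite in_fset_set; last exact: finite_normsq.
by rewrite unfold_in; apply/asboolP/idP.
Qed.

Lemma normsq_act w y : normsq (act w y) = normsq y.
Proof.
rewrite /normsq [RHS](reindex_inj (@perm_inj _ w.1)) /=; apply: eq_bigr => j _.
by rewrite mxE abszM; case: (w.2 j); rewrite ?expr0 ?expr1 mul1n.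
Qed.

Definition set_coord y (j : 'I_d) (v : int) : L := \row_i (if i == j then v else y ord0 i).

Lemma normsq_set_coord y j v : (normsq (set_coord y j v) + `|y ord0 j| ^ 2 = normsq y + `|v| ^ 2)%N.
Proof.
rewrite /normsq (bigD1 j)//= [in RHS](bigD1 j)//= mxE eqxx.
rewrite (eq_bigr (fun i => `|y ord0 i| ^ 2)%N); first by lia.
by move=> i /negbTE ij; rewrite mxE ij.
Qed.

Lemma set_coord_inj y y' j v : y ord0 j = y' ord0 j -> set_coord y j v = set_coord y' j v -> y = y'.
Proof.
move=> yj /rowP E; apply/rowP => i; have := E i; rewrite !mxE.
by case: eqP => // ->.
Qed.

Lemma multiplicity0_ge n y : (normsq y <= n)%N -> (d - n <= multiplicity y 0)%N.
Proof.
move=> yn; rewrite leq_subLR -[leqLHS](card_ord d) -(cardsC [set j : 'I_d | `|y ord0 j|%N == 0%N]) addnC.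
rewrite leq_add2r; apply: leq_trans yn; rewrite /normsq -sum1_card big_mkcond /=.
by apply: leq_sum => j _; rewrite !inE; case: absz.
Qed.

Lemma multiplicity_le y i : (multiplicity y i.+1 <= normsq y)%N.
Proof.
rewrite /multiplicity /normsq -sum1_card big_mkcond /=.
by apply: leq_sum => j _; rewrite inE; case: eqP => // ->; rewrite expn_gt0.
Qed.

(** Double counting of the pairs formed by a point with zero j-th coordinate and
    the same point with j-th coordinate 1: a point of squared norm at most n has at
    least d - n zero coordinates, and one of squared norm at most n + 1 has at
    most n + 1 coordinates equal to 1. *)
Lemma ball_step n : ((d - n) * size (ball n) <= n.+1 * size (ball n.+1))%N.
Proof.
pose ct (a : int) n := (\sum_(y <- ball n) \sum_(j < d) (y ord0 j == a))%N.
have h1 : ((d - n) * size (ball n) <= ct 0 n)%N.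
  rewrite /ct -sum_const_seq big_seq [X in (_ <= X)%N]big_seq.
  apply: leq_sum => y; rewrite mem_ball => yn; apply: (leq_trans (multiplicity0_ge yn)).
  rewrite /multiplicity -sum1_card big_mkcond /=; apply: leq_sum => j _; rewrite inE absz_eq0.
  by case: (_ == _).
have h2 : (ct 1 n.+1 <= n.+1 * size (ball n.+1))%N.
  rewrite /ct -sum_const_seq big_seq [X in (_ <= X)%N]big_seq.
  apply: leq_sum => y; rewrite mem_ball => yn; apply: leq_trans yn.
  apply: leq_trans (multiplicity_le y 0).
  rewrite /multiplicity -sum1_card [X in (_ <= X)%N]big_mkcond /=; apply: leq_sum => j _.
  by rewrite inE; case: (y ord0 j =P 1) => // ->.
apply: (leq_trans h1); apply: leq_trans h2; rewrite /ct exchange_big [X in (_ <= X)%N]exchange_big.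
apply: leq_sum => j _; rewrite !sum_bool_count.
apply: (@count_inj_le _ _ _ _ _ _ (fun y => set_coord y j 1)); first exact: ball_uniq.
  by move=> y y' _ _ /eqP y0 /eqP y'0; apply: set_coord_inj; rewrite y0.
move=> y; rewrite !mem_ball => yn /eqP y0; rewrite mxE eqxx andbT.
by have := normsq_set_coord y j 1; rewrite y0; move: yn; rewrite absz0 absz1; lia.
Qed.

(** Zeroing a coordinate of absolute value greater than m maps into the ball whose
    squared radius is smaller by (m+1)^2; a fibre is described by the position and
    the value of this coordinate. *)
Lemma count_bad_le m n :
  (count (fun y => ~~ small_coords m y) (ball n) <= d * n.*2.+1 * size (ball (n - m.+1 ^ 2)))%N.
Proof.
pose P (j : 'I_d) (v : 'I_n.*2.+1) := fun y : L => (m < `|y ord0 j|)%N && (y ord0 j == v%:Z - n%:Z).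
have PB j v : (count (P j v) (ball n) <= size (ball (n - m.+1 ^ 2)))%N.
  rewrite -[X in (_ <= X)%N]count_predT.
  apply: (@count_inj_le _ _ _ _ _ _ (fun y => set_coord y j 0)); first exact: ball_uniq.
    by move=> y y' _ _ /andP[_ /eqP E] /andP[_ /eqP E']; apply: set_coord_inj; rewrite E.
  move=> y; rewrite !mem_ball => yn /andP[my _]; rewrite andbT.
  have := normsq_set_coord y j 0; rewrite absz0.
  have : (m.+1 ^ 2 <= `|y ord0 j| ^ 2)%N by rewrite leq_exp2r.
  move: (m.+1 ^ 2)%N (`|y ord0 j| ^ 2)%N yn => a b; lia.
apply: (@leq_trans (\sum_(y <- ball n) \sum_j \sum_v P j v y)%N).
  rewrite -sum_bool_count big_seq [X in (_ <= X)%N]big_seq; apply: leq_sum => y; rewrite mem_ball => yn.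
  case: (boolP (small_coords m y)) => //= /forallPn[j]; rewrite -ltnNge => my.
  have yj : (`|y ord0 j| <= n)%N by apply: leq_trans yn; exact: absz_le_normsq.
  have vlt : (`|(y ord0 j + n%:Z)%R|%N < n.*2.+1)%N by move: (y ord0 j) yj => k; lia.
  rewrite (bigD1 j)//= (bigD1 (Ordinal vlt))//=.
  suff -> : P j (Ordinal vlt) y by lia.
  by rewrite /P my /=; move: (y ord0 j) yj => k; lia.
rewrite exchange_big; apply: (@leq_trans (\sum_(j < d) \sum_(v < n.*2.+1) size (ball (n - m.+1 ^ 2)))%N).
  apply: leq_sum => j _; rewrite exchange_big; apply: leq_sum => v _.
  by rewrite sum_bool_count.
by rewrite !sum_nat_const !card_ord mulnA.
Qed.

Lemma ball_gt0 n : (0 < size (ball n))%N.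
Proof.
have : (0 : L) \in ball n.
  by rewrite mem_ball /normsq big1// => j _; rewrite mxE.
by case: (ball n).
Qed.

Variable R : realType.

Lemma ball_size_ratio N i n : (0 < d)%N -> (2 * N <= d)%N -> (n + i <= N)%N ->
  (size (ball n))%:R <= (2 * N%:R / d%:R) ^+ i * (size (ball (n + i)))%:R :> R.
Proof.
move=> d0 Nd; elim: i => [|i IH] ni; first by rewrite expr0 mul1r addn0.
apply: (le_trans (IH _)); first by lia.
have q0 : 0 <= 2 * N%:R / d%:R :> R by rewrite divr_ge0// mulr_ge0.
rewrite exprSr -[leRHS]mulrA ler_wpM2l ?exprn_ge0// addnS.
have dR : 0 < d%:R :> R by rewrite ltr0n.
rewrite mulrAC ler_pdivlMr// -!natrM ler_nat.
have := ball_step (n + i); move: (size (ball (n + i))) (size (ball (n + i).+1)) => a b h.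
have h1 : (d * a <= 2 * ((d - (n + i)) * a))%N by rewrite mulnA leq_mul2r; apply/orP; right; lia.
have h2 : ((n + i).+1 * b <= N * b)%N by rewrite leq_mul2r; apply/orP; right; lia.
rewrite mulnC (leq_trans h1)// -mulnA leq_mul2l /=; exact: leq_trans h h2.
Qed.

Lemma bad_share_le m N n : (0 < d)%N -> (2 * N <= d)%N -> (n <= N)%N ->
  (count (fun y => ~~ small_coords m y) (ball n))%:R / (size (ball n))%:R <=
    d%:R * N.*2.+1%:R * (2 * N%:R / d%:R) ^+ (m.+1 ^ 2) :> R.
Proof.
move=> d0 Nd nN.
have q0 : 0 <= 2 * N%:R / d%:R :> R by rewrite divr_ge0// mulr_ge0.
rewrite ler_pdivrMr ?ltr0n ?ball_gt0//.
have [nD|Dn] := ltnP n (m.+1 ^ 2).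
  rewrite (_ : count _ _ = 0%N); first by rewrite !mulr_ge0// exprn_ge0.
  apply/eqP; rewrite -leqn0 leqNgt -has_count -all_predC; apply/allP => y.
  rewrite mem_ball /= negbK => yn; apply/forallP => j; rewrite leqNgt; apply/negP => my.
  have : (m.+1 ^ 2 <= `|y ord0 j| ^ 2)%N by rewrite leq_exp2r.
  by have := absz_normsq y j; lia.
have := @ball_size_ratio N (m.+1 ^ 2) (n - m.+1 ^ 2) d0 Nd; rewrite subnK// => /(_ nN) h.
rewrite -(mulrA _ (_ ^+ _)); apply: (@le_trans _ _ ((d * n.*2.+1)%:R * (size (ball (n - m.+1 ^ 2)))%:R)).
  by rewrite -natrM ler_nat count_bad_le.
rewrite natrM; apply: ler_pM => //; rewrite ?mulr_ge0//.
by rewrite ler_wpM2l// ler_nat; lia.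
Qed.

End Balls.

(** * Square sums over the lattice *)

Section L2.
Variables (R : realType) (d : nat).
Local Notation L := (lattice d).
Local Notation mu := (@counting L R).
Implicit Types (u v w : L -> R) (x y : L).

Lemma counting_bij (h : L -> L) : bijective h -> forall A : set L, mu (h @^-1` A)%classic = mu A.
Proof.
move=> hb A; rewrite /counting.
have hA : A = (h @` (h @^-1` A))%classic.
  case: hb => k hk kh; apply/seteqP; split=> [x Ax|_ [x Ax <-]//].
  by exists (k x); rewrite /= kh.
have [fA|nA] := pselect (finite_set (h @^-1` A)%classic); last first.
  rewrite !asboolF// => fA; apply: nA; apply: finite_preimage => // x y _ _.
  exact: bij_inj.
have fA' : finite_set A by rewrite hA; exact: finite_image.
rewrite !asboolT//; congr (_%:R%:E).
by rewrite {2}hA fset_set_image// card_imfset//=; exact: bij_inj.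
Qed.

Definition sqnorm v : \bar R := (\int[mu]_x ((v x) ^+ 2)%:E)%E.

Lemma sqnorm_ge0 v : (0 <= sqnorm v)%E.
Proof. by apply: integral_ge0 => x _; rewrite lee_fin sqr_ge0. Qed.

(** The counting measure is invariant under bijections. *)
Lemma sqnorm_bij v (h : L -> L) : bijective h -> sqnorm (v \o h) = sqnorm v.
Proof.
move=> hb; have mh : measurable_fun [set: L] h by [].
have := @ge0_integral_pushforward _ _ _ _ R h mh mu setT (fun x => ((v x) ^+ 2)%:E).
rewrite preimage_setT => E; rewrite /sqnorm -E//; last by move=> x _; rewrite lee_fin sqr_ge0.
apply: eq_measure_integral => A _ _; exact: counting_bij.
Qed.

Lemma integral_wsum (I : Type) (s : seq I) (c : I -> R) (v : I -> L -> R) :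
  (forall i, 0 <= c i) ->
  (\int[mu]_x (\sum_(i <- s) c i * v i x ^+ 2)%:E = \sum_(i <- s) (c i)%:E * sqnorm (v i))%E.
Proof.
move=> c0; under eq_integral do rewrite -sumEFin.
rewrite ge0_integral_sum//; last by move=> i x _; rewrite lee_fin mulr_ge0// sqr_ge0.
apply: eq_bigr => i _; under eq_integral do rewrite EFinM.
by rewrite ge0_integralZl_EFin// => x _; rewrite lee_fin sqr_ge0.
Qed.

Lemma sqnorm_wsum (I : Type) (s : seq I) (c : I -> R) (v : I -> L -> R) :
  (forall i, 0 <= c i) ->
  (sqnorm (fun x => \sum_(i <- s) c i * v i x)%R <=
   (\sum_(i <- s) c i)%R%:E * \sum_(i <- s) (c i)%:E * sqnorm (v i))%E.
Proof.
move=> c0; have S0 : 0 <= \sum_(i <- s) c i by exact: sumr_ge0.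
rewrite -integral_wsum// -ge0_integralZl_EFin//; last first.
  by move=> x _; rewrite lee_fin sumr_ge0// => i _; rewrite mulr_ge0// sqr_ge0.
apply: ge0_le_integral => //= x _; first by rewrite lee_fin sqr_ge0.
by rewrite -EFinM lee_fin sqr_wsum_le.
Qed.

Lemma sqnorm_wsum_const (I : Type) (s : seq I) (c : I -> R) (v : I -> L -> R) (e : \bar R) :
  (0 <= e)%E ->
  (forall i, 0 <= c i) -> (forall i, sqnorm (v i) <= e)%E ->
  (sqnorm (fun x => \sum_(i <- s) c i * v i x)%R <= ((\sum_(i <- s) c i) ^+ 2)%:E * e)%E.
Proof.
move=> e0 c0 ve; apply: (le_trans (sqnorm_wsum s v c0)).
have S0 : 0 <= \sum_(i <- s) c i by exact: sumr_ge0.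
rewrite expr2 EFinM -muleA lee_wpmul2l ?lee_fin//.
rewrite -sumEFin ge0_sume_distrl; last by move=> i _; rewrite lee_fin.
by apply: lee_sum => i _; rewrite lee_wpmul2l ?lee_fin.
Qed.

Lemma sqnormD_le v w : (sqnorm (fun x => v x + w x)%R <= 2%:E * sqnorm v + 2%:E * sqnorm w)%E.
Proof.
have := @sqnorm_wsum bool [:: true; false] (fun=> 1) (fun b => if b then v else w) (fun=> ler01).
rewrite !big_cons !big_nil addr0 adde0 !mul1e.
rewrite (_ : 1 + 1 = 2 :> R)// muleDr//; last by rewrite ge0_adde_def// inE sqnorm_ge0.
apply: le_trans; rewrite le_eqVlt; apply/orP; left; apply/eqP; congr sqnorm.
by apply/funext => x; rewrite !big_cons !big_nil !mul1r addr0.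
Qed.

End L2.

Section Good.
Import fintype finset.
Variables (R : realType) (d m N : nat) (c : 'I_d -> 'I_m).
Local Notation L := (lattice d).
Variable u : L -> R.
Hypothesis u0 : forall x, 0 <= u x.
Hypothesis hN : forall i, (8 * N + 16 <= #|colour c i|)%N.

Definition cubemax (w : sgnperm d) x : R := slices_max c N (fun K => u (toggle c w K x)) finset.set0.
Definition goodmax x : R := \sum_w #|{: sgnperm d}|%:R^-1 * cubemax w x.

Lemma card_sgnperm_gt0 : 0 < #|{: sgnperm d}|%:R :> R.
Proof. by rewrite ltr0n; apply/card_gt0P; exists (1%g, [ffun=> false]). Qed.

(** The mean of [cubemax w] over signed permutations [w] dominates all the orbit
    averages at once. *)
Lemma orbsum_le x y : small_coords m y -> (normsq y <= N)%N ->
  #|{: sgnperm d}|%:R^-1 * orbsum u x y <= goodmax x.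
Proof.
move=> ym yN.
have yi (i : 'I_m) : (multiplicity y i.+1 <= N)%N by apply: leq_trans yN; exact: multiplicity_le.
rewrite /goodmax -mulr_sumr ler_wpM2l ?invr_ge0// -(slices_orbsum (c := c))//; last first.
  by move=> i; apply: leq_trans (hN i); have := yi i; lia.
by apply: ler_sum => w _; apply: (@slices_max_ge R _ m c N (fun i : 'I_m => multiplicity y i.+1)).
Qed.

Lemma cubemax_toggle w A x : cubemax w (toggle c w A x) = slices_max c N (fun K => u (toggle c w K x)) A.
Proof.
rewrite /cubemax -[RHS]slices_max_shift; congr slices_max; apply/funext => K.
by rewrite -toggle_symd symdC.
Qed.

(** Transference: each toggle preserves the counting measure, so the integral may
    be averaged over the whole hypercube. *)
Lemma sqnorm_toggle_mean (v : L -> R) w :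
  sqnorm v = (\int[@counting L R]_x (\sum_(A : {set 'I_d}) 2 ^- d * v (toggle c w A x) ^+ 2)%:E)%E.
Proof.
rewrite (integral_wsum _ (fun A x => v (toggle c w A x))); last first.
  by move=> A; rewrite invr_ge0 exprn_ge0.
rewrite (eq_bigr (fun=> (2 ^- d)%:E * sqnorm v)%E); last first.
  move=> A _; congr (_ * _)%E; apply: (sqnorm_bij v (h := toggle c w A)).
  exact: inv_bij (toggleK c w A).
rewrite -ge0_sume_distrl; last by move=> A _; rewrite lee_fin invr_ge0 exprn_ge0.
rewrite sumEFin sumr_const -cardsT -powersetT card_powerset cardsT card_ord.
by rewrite -[X in X%:E]mulr_natl natrX mulfV ?expf_neq0// mul1e.
Qed.

(** Along the orbit of [x], the function [cubemax w] is the maximal function of the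
    hypercube for u restricted to this orbit. *)
Lemma sqnorm_cubemax w : (sqnorm (cubemax w) <= (slice_const R ^+ m)%:E * sqnorm u)%E.
Proof.
have C0 : 0 <= slice_const R ^+ m by rewrite exprn_ge0// /slice_const; lra.
rewrite (sqnorm_toggle_mean (cubemax w) w) (sqnorm_toggle_mean u w) -ge0_integralZl_EFin//; last first.
  move=> x _; rewrite lee_fin sumr_ge0// => A _.
  by rewrite mulr_ge0 ?sqr_ge0// invr_ge0 exprn_ge0.
apply: ge0_le_integral => //= x _.
  rewrite lee_fin sumr_ge0// => A _.
  by rewrite mulr_ge0 ?sqr_ge0// invr_ge0 exprn_ge0.
rewrite -EFinM lee_fin -!mulr_sumr mulrCA ler_wpM2l ?invr_ge0 ?exprn_ge0//.
under eq_bigr do rewrite cubemax_toggle.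
exact: slices_max_l2.
Qed.

Lemma sqnorm_goodmax : (sqnorm goodmax <= (slice_const R ^+ m)%:E * sqnorm u)%E.
Proof.
have C0 : 0 <= slice_const R ^+ m by rewrite exprn_ge0// /slice_const; lra.
have e0 : (0 <= (slice_const R ^+ m)%:E * sqnorm u)%E by rewrite mule_ge0 ?sqnorm_ge0 ?lee_fin.
have := @sqnorm_wsum_const R d _ (index_enum (sgnperm d)) (fun=> #|{: sgnperm d}|%:R^-1)
  cubemax _ e0 _ sqnorm_cubemax.
have g0 : 0 <= #|{: sgnperm d}|%:R^-1 :> R by rewrite invr_ge0.
rewrite sumr_const -[X in X ^+ 2]mulr_natl mulfV ?gt_eqF ?card_sgnperm_gt0// expr1n mul1e.
by move=> h; exact: h.
Qed.

End Good.

(** * Averages over balls *)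

Section Averages.
Variables (R : realType) (d : nat).
Local Notation L := (lattice d).
Implicit Types (u v w : L -> R) (x y : L).

Definition ball_avg n u x : R := (size (ball d n))%:R^-1 * \sum_(y <- ball d n) u (x - y).
Definition ball_part (P : pred L) n u x : R :=
  (size (ball d n))%:R^-1 * \sum_(y <- ball d n | P y) u (x - y).

Lemma act_inj (w : sgnperm d) : injective (act w).
Proof.
move=> y y' /rowP E; apply/rowP => j; have := E (w.1^-1%g j).
rewrite !mxE permKV; apply: mulfI.
by rewrite expf_neq0.
Qed.

Lemma small_coords_act m (w : sgnperm d) y : small_coords m y -> small_coords m (act w y).
Proof.
move=> /forallP ym; apply/forallP => j; rewrite mxE abszM.
by case: (w.2 j); rewrite ?expr0 ?expr1 mul1n.
Qed.

(** Points with small coordinates form a union of orbits in each ball. *)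
Lemma ball_part_orbsum m n u x : ball_part (small_coords m) n u x =
  (size (ball d n))%:R^-1 * \sum_(y <- ball d n | small_coords m y)
     (#|{: sgnperm d}|%:R^-1 * orbsum u x y).
Proof.
congr (_ * _); rewrite -mulr_sumr /orbsum exchange_big /=.
have E (w : sgnperm d) : \sum_(y <- ball d n | small_coords m y) u (x - act w y) =
           \sum_(y <- ball d n | small_coords m y) u (x - y).
  rewrite -[LHS]big_filter -[RHS]big_filter; set s := [seq y <- ball d n | small_coords m y].
  rewrite -(big_map (act w) xpredT (fun y => u (x - y))); apply: perm_big.
  have us : uniq s by rewrite filter_uniq// ball_uniq.
  have um : uniq (map (act w) s) by rewrite map_inj_uniq//; exact: act_inj.
  have sub : {subset map (act w) s <= s}.
    move=> z /mapP[y]; rewrite mem_filter => /andP[ym yb] ->.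
    by rewrite mem_filter small_coords_act// mem_ball normsq_act -mem_ball.
  have [_ ss] := uniq_min_size um sub (eq_leq (esym (size_map _ _))).
  exact: uniq_perm.
under [X in _ * X]eq_bigr do rewrite E.
by rewrite sumr_const -[X in _ * X]mulr_natl mulrA mulVf ?mul1r// gt_eqF ?card_sgnperm_gt0.
Qed.

Lemma ball_sizeR n : 0 < (size (ball d n))%:R :> R.
Proof. by rewrite ltr0n ball_gt0. Qed.

(** The averages over all balls share the first majorant; only the exceptional
    points depend on the ball. *)
Lemma ball_avg_split m N (c : 'I_d -> 'I_m) u n x : (forall x, 0 <= u x) -> (n <= N)%N ->
  (forall i, (8 * N + 16 <= #|colour c i|)%N) ->
  ball_avg n u x <= goodmax N c u x + ball_part (fun y => ~~ small_coords m y) n u x.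
Proof.
move=> u0 nN hN.
have -> : ball_avg n u x = ball_part (small_coords m) n u x + ball_part (fun y => ~~ small_coords m y) n u x.
  by rewrite /ball_avg /ball_part (bigID (small_coords m)) mulrDr.
rewrite lerD2r ball_part_orbsum ler_pdivrMl ?ball_sizeR//.
have V0 : 0 <= goodmax N c u x.
  by apply: sumr_ge0 => w _; rewrite mulr_ge0 ?invr_ge0// slices_max_ge0.
apply: (@le_trans _ _ (\sum_(y <- ball d n | small_coords m y) goodmax N c u x)).
  rewrite big_seq_cond [leRHS]big_seq_cond; apply: ler_sum => y /andP[yb ym].
  by apply: orbsum_le => //; apply: leq_trans nN; rewrite -mem_ball.
rewrite big_const_seq iter_addr_0 -[leLHS]mulr_natl ler_wpM2r// ler_nat.
exact: count_size.
Qed.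

Lemma sqnorm_ball_part_sum (P : pred L) M u (S : R) :
  \sum_(n < M) (count P (ball d n))%:R / (size (ball d n))%:R <= S ->
  (sqnorm (fun x => \sum_(n < M) ball_part P n u x)%R <= (S ^+ 2)%:E * sqnorm u)%E.
Proof.
move=> HS.
pose s := [seq (n, y) | n <- index_enum 'I_M, y <- [seq y <- ball d (n : 'I_M) | P y]].
pose cc (p : 'I_M * L) : R := (size (ball d p.1))%:R^-1.
have cc0 p : 0 <= cc p by rewrite invr_ge0.
have sb x : bijective (fun z : L => z - x : L).
  by exists (fun z => z + x) => z; rewrite ?subrK ?addrK.
have := @sqnorm_wsum_const R d _ s cc (fun p x => u (x - p.2)) (sqnorm u) (sqnorm_ge0 u) cc0.
have ve (p : 'I_M * L) : (sqnorm (fun x : L => u (x - p.2)%R) <= sqnorm u)%E.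
  by rewrite (sqnorm_bij u (sb p.2)).
move=> /(_ ve).
have Es (F : 'I_M * L -> R) : \sum_(p <- s) cc p * F p =
    \sum_(n < M) (size (ball d n))%:R^-1 * \sum_(y <- ball d n | P y) F (n, y).
  rewrite /s big_allpairs_dep; apply: eq_bigr => n _.
  by rewrite big_filter mulr_sumr.
have -> : (fun x => \sum_(p <- s) cc p * u (x - p.2)) = (fun x => \sum_(n < M) ball_part P n u x).
  by apply/funext => x; rewrite (Es (fun p => u (x - p.2))).
move/le_trans; apply; apply: lee_wpmul2r; first exact: sqnorm_ge0.
have Ec : \sum_(p <- s) cc p = \sum_(n < M) (count P (ball d n))%:R / (size (ball d n))%:R.
  transitivity (\sum_(p <- s) cc p * 1); first by apply: eq_bigr => p _; rewrite mulr1.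
  rewrite (Es (fun=> 1)); apply: eq_bigr => n _.
  by rewrite big_const_seq iter_addr_0 mulrC.
have c0 : 0 <= \sum_(p <- s) cc p by exact: sumr_ge0.
by rewrite lee_fin lerXn2r ?nnegrE// ?Ec//; apply: le_trans HS; rewrite -Ec.
Qed.

End Averages.

Section Scales.
Variables (R : realType) (d : nat).
Local Notation L := (lattice d).

Definition block_colour m (m0 : (0 < m)%N) (j : 'I_d) : 'I_m := Ordinal (ltn_pmod j m0).

Lemma block_colour_size m (m0 : (0 < m)%N) (i : 'I_m) :
  (d %/ m <= #|colour (block_colour m0) i|)%N.
Proof.
have lt (k : 'I_(d %/ m)) : (k * m + i < d)%N.
  apply: (@leq_trans (k.+1 * m)); first by rewrite mulSn addnC ltn_add2r.
  by apply: leq_trans (leq_trunc_div d m); rewrite leq_mul2r ltn_ord orbT.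
rewrite -[leqLHS]card_ord -(card_imset _ (_ : injective (fun k => Ordinal (lt k)))); last first.
  move=> k k' [] /eqP; rewrite eqn_add2r eqn_pmul2r// => /eqP kk; exact: val_inj.
apply/subset_leq_card/fintype.subsetP => j /imsetP[k _ ->].
by rewrite inE -val_eqE /= modnMDl modn_small.
Qed.

(** With r of order d^(- 2 eps), the power r^m compensates d^3 as soon as
    2 eps m >= 3. *)
Lemma bad_share_sum m N (r : R) : (2 * N <= d)%N -> (2 <= d)%N ->
  2 * N%:R / d%:R <= r -> r <= 1 ->
  \sum_(n < N.+1) (count (fun y : L => ~~ small_coords m y) (ball d n))%:R / (size (ball d n))%:R
  <= 2 * d%:R ^+ 3 * r ^+ m.
Proof.
move=> Nd d2 Nr r1; have d0 : (0 < d)%N by exact: ltnW.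
set q := 2 * N%:R / d%:R in Nr.
have q0 : 0 <= q by rewrite divr_ge0// mulr_ge0.
apply: (@le_trans _ _ (\sum_(n < N.+1) d%:R * N.*2.+1%:R * q ^+ (m.+1 ^ 2))).
  by apply: ler_sum => n _; apply: bad_share_le => //; rewrite -ltnS.
rewrite sumr_const card_ord -[leLHS]mulr_natl mulrA; apply: ler_pM; rewrite ?mulr_ge0 ?exprn_ge0//.
  rewrite -!natrM -natrX -natrM ler_nat !expnS expn0 muln1.
  have h1 : (N.+1 <= d)%N by lia.
  have h2 : (N.*2.+1 <= 2 * d)%N by lia.
  rewrite (_ : 2 * (d * (d * d)) = d * (d * (2 * d)))%N; last by ring.
  by rewrite leq_mul// leq_mul.
apply: (@le_trans _ _ (q ^+ m)); last by rewrite lerXn2r// ?nnegrE//; apply: le_trans Nr.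
by apply: ler_wiXn2l => //; [exact: le_trans r1|nia].
Qed.

End Scales.

(** * The maximal inequality *)

Section Main.
Variables (R : realType).

Lemma ball_avg_ge0 d n (u : lattice d -> R) x : (forall x, 0 <= u x) -> 0 <= ball_avg n u x.
Proof. by move=> u0; rewrite mulr_ge0 ?invr_ge0// sumr_ge0. Qed.

Lemma ball_part_ge0 d P n (u : lattice d -> R) x : (forall x, 0 <= u x) -> 0 <= ball_part P n u x.
Proof. by move=> u0; rewrite mulr_ge0 ?invr_ge0// sumr_ge0. Qed.

(** A bounded number of balls is handled by adding up the averages. *)
Lemma l2_small d N (u : lattice d -> R) : (forall x, 0 <= u x) ->
  exists V : lattice d -> R, (forall n x, (n <= N)%N -> ball_avg n u x <= V x) /\
    (sqnorm V <= (N.+1%:R ^+ 2)%:E * sqnorm u)%E.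
Proof.
move=> u0; exists (fun x => \sum_(n < N.+1) ball_part predT n u x); split=> [n x nN|].
  have nN' : (n < N.+1)%N by [].
  rewrite (bigD1 (Ordinal nN'))//= lerDl.
  by apply: sumr_ge0 => i _; exact: ball_part_ge0.
apply: sqnorm_ball_part_sum; rewrite (_ : N.+1%:R = \sum_(n < N.+1) 1); last by rewrite sumr_const card_ord.
by apply: ler_sum => n _; rewrite count_predT divff// gt_eqF// ball_sizeR.
Qed.

Lemma l2_large d m N (u : lattice d -> R) (r : R) : (forall x, 0 <= u x) -> (0 < m)%N ->
  ((8 * N + 16) * m <= d)%N -> 2 * N%:R / d%:R <= r -> r <= 1 ->
  exists V : lattice d -> R, (forall n x, (n <= N)%N -> ball_avg n u x <= V x) /\
    (sqnorm V <= (2 * slice_const R ^+ m + 2 * (2 * d%:R ^+ 3 * r ^+ m) ^+ 2)%:E * sqnorm u)%E.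
Proof.
move=> u0 m0 Nm Nr r1.
have d16 : (8 * N + 16 <= d)%N by apply: leq_trans Nm; rewrite leq_pmulr.
pose c := @block_colour d m m0.
have hN i : (8 * N + 16 <= #|colour c i|)%N.
  by rewrite (leq_trans _ (block_colour_size d m0 i))// leq_divRL.
pose B x := \sum_(n < N.+1) ball_part (fun y => ~~ small_coords m y) n u x.
exists (fun x => goodmax N c u x + B x); split=> [n x nN|].
  apply: (le_trans (ball_avg_split x u0 nN hN)); rewrite lerD2l.
  have nN' : (n < N.+1)%N by [].
  rewrite /B (bigD1 (Ordinal nN'))//= lerDl.
  by apply: sumr_ge0 => i _; exact: ball_part_ge0.
apply: (le_trans (sqnormD_le _ _)).
have Nd : (2 * N <= d)%N by lia.
have d2 : (2 <= d)%N by lia.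
have bs := bad_share_sum m Nd d2 Nr r1.
have h1 := sqnorm_goodmax u0 hN.
have h2 := sqnorm_ball_part_sum u bs.
have C0 : 0 <= slice_const R ^+ m by rewrite exprn_ge0// /slice_const; lra.
have B0 := sqr_ge0 (2 * d%:R ^+ 3 * r ^+ m).
move: (slice_const R ^+ m) ((2 * d%:R ^+ 3 * r ^+ m) ^+ 2) C0 B0 h1 h2 => a b a0 b0 h1 h2.
rewrite [in leRHS]EFinD ge0_muleDl ?lee_fin ?mulr_ge0//.
by apply: leeD; rewrite EFinM -muleA lee_wpmul2l.
Qed.

Lemma l2_max (eps : R) : 0 < eps -> exists2 C : R, 1 <= C &
  forall d, (0 < d)%N -> forall u : lattice d -> R, (forall x, 0 <= u x) ->
  exists V : lattice d -> R,
    (forall t x, 0 <= t <= d%:R `^ (2^-1 - eps) -> ball_avg (Num.truncn (t ^+ 2)) u x <= V x) /\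
    (sqnorm V <= C%:E * sqnorm u)%E.
Proof.
move=> e0.
pose m := (Num.truncn (3 / (2 * eps))).+1.
have m3 : 3 <= 2 * eps * m%:R.
  rewrite mulrC -ler_pdivrMr ?mulr_gt0//; apply: ltW; exact: truncnS_gt.
(* From dimension D on, d^(- 2 eps) <= 1 / (16 m), so every colour class is large
   enough for the slices that occur. *)
pose D := (Num.truncn (Num.max (32 * m%:R) ((16 * m%:R) `^ (2 * eps)^-1))).+1.
pose C := 2 * slice_const R ^+ m + 2 * (2 * 2 ^+ m) ^+ 2 + D.+1%:R ^+ 2.
have C0 : 0 <= slice_const R ^+ m by rewrite exprn_ge0// /slice_const; lra.
have Da : 1 <= D.+1%:R ^+ 2 :> R by rewrite -natrX ler1n expn_gt0.
have Ca : 0 <= 2 * (2 * 2 ^+ m) ^+ 2 :> R by rewrite mulr_ge0 ?sqr_ge0.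
exists C => [|d d0 u u0]; first by rewrite /C; lra.
pose N := Num.truncn (d%:R `^ (1 - 2 * eps) : R).
have NE : N%:R <= d%:R `^ (1 - 2 * eps) :> R by rewrite truncn_le ?powR_ge0.
have d1 : 1 <= d%:R :> R by rewrite ler1n.
have dp : 0 < d%:R :> R by rewrite ltr0n.
have tN (t : R) : 0 <= t <= d%:R `^ (2^-1 - eps) -> (Num.truncn (t ^+ 2) <= N)%N.
  move=> /andP[t0 tT]; apply: le_truncn.
  rewrite (_ : 1 - 2 * eps = (2^-1 - eps) * 2%:R); last by field.
  by rewrite powRrM powR_mulrn ?powR_ge0// lerXn2r// nnegrE ?powR_ge0.
suff [V [HV SV]] : exists V : lattice d -> R, (forall n x, (n <= N)%N -> ball_avg n u x <= V x) /\
    (sqnorm V <= C%:E * sqnorm u)%E.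
  by exists V; split=> // t x /tN; apply: HV.
have Csq (a : R) : a <= C -> (a%:E * sqnorm u <= C%:E * sqnorm u)%E.
  by move=> aC; apply: lee_wpmul2r; [exact: sqnorm_ge0|rewrite lee_fin].
have [dD|Dd] := ltnP d D.
  have [V [HV SV]] := l2_small N u0.
  exists V; split=> //; apply: (le_trans SV); apply: Csq.
  apply: (@le_trans _ _ (D.+1%:R ^+ 2)); last by rewrite /C; lra.
  rewrite lerXn2r ?nnegrE// ler_nat ltnS; apply: leq_trans (ltnW dD).
  rewrite -(ler_nat R); apply: (le_trans NE).
  by rewrite -[leRHS]powRr1// ler_powR//; lra.
have Dd' : Num.max (32 * m%:R) ((16 * m%:R) `^ (2 * eps)^-1) <= d%:R.
  by apply: ltW; apply: (lt_le_trans (truncnS_gt _)); rewrite ler_nat.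
have m1 : 1 <= m%:R :> R by rewrite ler1n.
have dm : 32 * m%:R <= d%:R :> R by rewrite (le_trans _ Dd')// le_max lexx.
pose del : R := d%:R `^ (- (2 * eps)).
have del0 : 0 <= del by exact: powR_ge0.
have delm : del <= (16 * m%:R)^-1.
  have h : 16 * m%:R <= d%:R `^ (2 * eps).
    have -> : 16 * m%:R = ((16 * m%:R) `^ (2 * eps)^-1) `^ (2 * eps).
      by rewrite -powRrM mulVf ?powRr1// ?mulr_ge0// gt_eqF// mulr_gt0.
    apply: ge0_ler_powR; [by rewrite mulr_ge0// ltW|by rewrite nnegrE powR_ge0|by rewrite nnegrE|].
    by rewrite (le_trans _ Dd')// le_max lexx orbT.
  by rewrite /del powRN lef_pV2 ?posrE ?powR_gt0 ?mulr_gt0.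
have Ndel : N%:R <= d%:R * del.
  apply: (le_trans NE); rewrite powRD; last by rewrite (gt_eqF dp) implybT.
  by rewrite powRr1// ltW.
have m16 : 0 < 16 * m%:R :> R by rewrite mulr_gt0.
have delm1 : del * (16 * m%:R) <= 1.
  by rewrite -[leRHS](mulVf (lt0r_neq0 m16)) ler_wpM2r// ltW.
have Nm : ((8 * N + 16) * m <= d)%N.
  rewrite -(ler_nat R) natrM natrD natrM.
  have : N%:R * m%:R <= d%:R * (del * m%:R) by rewrite mulrA ler_wpM2r.
  have : d%:R * (del * (16 * m%:R)) <= d%:R * 1 by rewrite ler_wpM2l// ltW.
  nra.
have Nr : 2 * N%:R / d%:R <= 2 * del by rewrite ler_pdivrMr//; lra.
have r1 : 2 * del <= 1 by nra.
have [V [HV SV]] := @l2_large d m N u (2 * del) u0 isT Nm Nr r1.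
exists V; split=> //; apply: (le_trans SV); apply: Csq.
suff : (2 * d%:R ^+ 3 * (2 * del) ^+ m) ^+ 2 <= (2 * 2 ^+ m) ^+ 2 :> R by rewrite /C; lra.
rewrite lerXn2r ?nnegrE ?mulr_ge0 ?exprn_ge0 ?mulr_ge0//.
rewrite exprMn (_ : 2 * _ * _ = 2 * 2 ^+ m * (d%:R ^+ 3 * del ^+ m)); last by ring.
rewrite ler_piMr ?mulr_ge0 ?exprn_ge0//.
rewrite -[del ^+ m]powR_mulrn// -powRrM -[d%:R ^+ 3]powR_mulrn ?(ltW dp)// -powRD; last first.
  by rewrite (gt_eqF dp) implybT.
by rewrite -[leRHS](powRr0 d%:R) ler_powR//; lra.
Qed.

Lemma normc_sum (I : Type) (s : seq I) (F : I -> R[i]) :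
  ComplexField.Normc.normc (\sum_(i <- s) F i) <= \sum_(i <- s) ComplexField.Normc.normc (F i).
Proof.
elim: s => [|i s IH]; first by rewrite !big_nil ComplexField.Normc.normc0.
by rewrite !big_cons (le_trans (le_normcD _ _))// lerD2l.
Qed.

Lemma normc_ge0 (z : R[i]) : 0 <= ComplexField.Normc.normc z.
Proof. by case: z => a b; rewrite /= sqrtr_ge0. Qed.

Lemma normc_avg d t (f : lattice d -> R[i]) x :
  ComplexField.Normc.normc (avg t f x) <=
  ball_avg (Num.truncn (t ^+ 2)) (fun x => ComplexField.Normc.normc (f x)) x.
Proof.
rewrite /avg lattice_ballE fsbig_finite; last exact: finite_normsq.
rewrite ComplexField.Normc.normcM ComplexField.Normc.normcV.
have -> : ComplexField.Normc.normc (#|` fset_set [set y : lattice d |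
    (normsq y <= Num.truncn (t ^+ 2))%N]%classic|%:R : R[i]) =
    (size (ball d (Num.truncn (t ^+ 2))))%:R.
  by rewrite -[_%:R in LHS]/(1 *+ _) normcMn ComplexField.Normc.normc1.
apply: ler_wpM2l; first by rewrite invr_ge0.
exact: normc_sum.
Qed.

(** Jensen's inequality: sum Young's inequality for the product of u(y) and
    M^(r-1) over the ball, M being the average of u. *)
Lemma ball_avg_powR d n (u : lattice d -> R) x (r : R) : (forall x, 0 <= u x) -> 1 <= r ->
  ball_avg n u x `^ r <= ball_avg n (fun x => u x `^ r) x.
Proof.
move=> u0 r1; have m0 := ball_avg_ge0 n x u0; set M := ball_avg n u x in m0 *.
have [->|r_ne1] := eqVneq r 1.
  rewrite powRr1// /M /ball_avg [in leRHS](eq_bigr (fun y => u (x - y)))// => y _.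
  by rewrite powRr1.
have r1' : 1 < r by rewrite lt_neqAle eq_sym r_ne1.
have r0 : 0 < r by lra.
pose q := r / (r - 1).
have q0 : 0 < q by rewrite divr_gt0//; lra.
have rq : r^-1 + q^-1 = 1 by rewrite /q invf_div; field; lra.
have Y y : u y * M `^ (r - 1) <= u y `^ r / r + M `^ r / q.
  have := conjugate_powR (u0 y) (powR_ge0 M (r - 1)) r0 q0 rq.
  by rewrite -powRrM (_ : (r - 1) * q = r)// /q; field; lra.
have S : M * M `^ (r - 1) <= ball_avg n (fun x => u x `^ r) x / r + M `^ r / q.
  have -> : M `^ r / q = ball_avg n (fun=> M `^ r / q) x.
    by rewrite /ball_avg big_const_seq count_predT iter_addr_0 -[X in _ = _ * X]mulr_natl mulrA mulVf ?mul1r// gt_eqF// ball_sizeR.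
  rewrite /M /ball_avg -/M -!mulrA -mulrDr ler_wpM2l ?invr_ge0// !mulr_suml -big_split /=.
  by apply: ler_sum => y _; exact: Y.
have MM : M * M `^ (r - 1) = M `^ r.
  have [->|Mn0] := eqVneq M 0; first by rewrite mul0r powR0// gt_eqF.
  by rewrite -{1}(powRr1 m0) -powRD ?Mn0 ?implybT//; congr (_ `^ _); ring.
rewrite MM in S.
have : M `^ r / r <= ball_avg n (fun x => u x `^ r) x / r.
  have -> : M `^ r / r = M `^ r - M `^ r / q.
    by rewrite -{2}[M `^ r]mulr1 -rq mulrDr; ring.
  lra.
by rewrite ler_pM2r// invr_gt0.
Qed.

Lemma counting_pos d : (0 < @counting (lattice d) R setT)%E.
Proof.
rewrite /counting; case: asboolP => [fT|_]; last exact: ltry.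
rewrite lte_fin ltr0n cardfs_gt0; apply/fset0Pn; exists 0.
by rewrite in_fset_set// inE.
Qed.

(** Only the empty set is negligible for the counting measure. *)
Lemma ae_counting d (P : lattice d -> Prop) :
  (\forall x \ae @counting (lattice d) R, P x) -> forall x, P x.
Proof.
case=> A [_ A0 PA] x; apply: contrapT => nPx.
move: A0; rewrite /counting; case: asboolP => // fA.
move=> /eqP; rewrite eqe pnatr_eq0 cardfs_eq0 => /eqP A0.
have : x \in fset_set A by rewrite in_fset_set// inE; exact: PA.
by rewrite A0 inE.
Qed.

End Main.

Theorem theorem1p1 (R : realType) (eps : R) (heps : 0 < eps) :
  exists C : R, 0 < C /\
    forall (d : nat), (0 < d)%N ->
    forall (p : \bar R), (2%:E <= p)%E ->
    forall (f : lattice d -> R[i]), in_lp p f ->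
      (lp_norm p (max_avg (d%:R `^ (2^-1 - eps)) f) <= C%:E * lp_normc p f)%E.
Proof.
have [C C1 HC] := l2_max heps.
have C0 : 0 < C by lra.
exists C; split=> // d d0 p p2 f _.
set T : R := d%:R `^ (2^-1 - eps).
pose nf x := ComplexField.Normc.normc (f x).
have nf0 x : 0 <= nf x by exact: normc_ge0.
have T0 : 0 <= T by exact: powR_ge0.
have max0 x : (0 <= max_avg T f x)%E.
  apply: (@le_trans _ _ (ComplexField.Normc.normc (avg 0 f x))%:E); first by rewrite lee_fin normc_ge0.
  by apply: ereal_sup_ubound => /=; exists 0 => //=; rewrite lexx T0.
case: p p2 => [p| |//] p2; last first.
  rewrite /lp_normc /lp_norm unlock counting_pos.
  set s := ess_sup _ (abse \o (fun x => (_ (f x))%:E)).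
  have fs x : ((nf x)%:E <= s)%E.
    have := ae_counting (ess_sup_ge (@counting (lattice d) R) (abse \o (fun x => (nf x)%:E))) x.
    by rewrite /= ger0_norm.
  have s0 : (0 <= s)%E by apply: le_trans (fs 0); rewrite lee_fin.
  apply: (@le_trans _ _ s); last by rewrite lee_pemull// lee_fin.
  apply/ess_supP; apply: nearW => x /=; rewrite gee0_abs//.
  apply: ge_ereal_sup => _ [t /= tT <-].
  apply: (@le_trans _ _ (ball_avg (Num.truncn (t ^+ 2)) nf x)%:E); first by rewrite lee_fin normc_avg.
  case: s s0 fs => [s| |//] s0 fs; last by rewrite leey.
  rewrite lee_fin ler_pdivrMl ?ball_sizeR//.
  rewrite mulrC mulr_natr -(count_predT (ball d _)) -iter_addr_0 -big_const_seq.
  by apply: ler_sum => y _; rewrite -lee_fin.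
have {}p2 : 2 <= p by rewrite -lee_fin.
have p0 : 0 < p by lra.
pose r := p / 2.
have r1 : 1 <= r by rewrite /r; lra.
have r0 : 0 < r by lra.
pose u x := nf x `^ r.
have u0 x : 0 <= u x by exact: powR_ge0.
have [V [HV SV]] := HC d d0 u u0.
have V0 x : 0 <= V x.
  by apply: le_trans (HV 0 x _); [exact: ball_avg_ge0|rewrite lexx T0].
have maxV x : (max_avg T f x <= (V x `^ r^-1)%:E)%E.
  apply: ge_ereal_sup => _ [t /= tT <-]; rewrite lee_fin.
  apply: (le_trans (normc_avg t f x)); rewrite -/nf.
  set M := ball_avg _ _ _; have M0 : 0 <= M by exact: ball_avg_ge0.
  rewrite -[leLHS](powRr1 M0) -(mulfV (lt0r_neq0 r0)) powRrM.
  apply: ge0_ler_powR; rewrite ?nnegrE ?powR_ge0 ?invr_ge0// ?(ltW r0)//.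
  by apply: (le_trans (ball_avg_powR _ _ nf0 r1)); exact: HV.
have sqE (v : lattice d -> R) : (forall x, 0 <= v x) ->
  forall x, (v x `^ r^-1) `^ p = v x ^+ 2.
  move=> v0 x; rewrite -powRrM (_ : r^-1 * p = 2%:R); first by rewrite powR_mulrn.
  by rewrite /r; field; lra.
rewrite /lp_normc /lp_norm unlock.
have I1 : (\int[@counting (lattice d) R]_x (`|max_avg T f x| `^ p) <= C%:E *
     \int[@counting (lattice d) R]_x (`|(nf x)%:E| `^ p))%E.
  apply: (@le_trans _ _ (sqnorm V)).
    apply: ge0_le_integral => //= [x _|x _]; first exact: poweR_ge0.
    rewrite gee0_abs// -(sqE V V0) -poweR_EFin.
    apply: gt0_ler_poweR; [exact: ltW| | |exact: maxV].
      by rewrite in_itv/= leey max0.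
    by rewrite in_itv/= leey lee_fin powR_ge0.
  apply: (le_trans SV); rewrite lee_wpmul2l ?lee_fin ?(ltW C0)//.
  apply: ge0_le_integral => //= x _; first by rewrite lee_fin sqr_ge0.
  rewrite ger0_norm// lee_fin -powR_mulrn// -powRrM.
  by rewrite (_ : r * 2%:R = p) ?lexx// /r; field.
have I0 : (0 <= \int[@counting (lattice d) R]_x (`|(nf x)%:E| `^ p))%E.
  by apply: integral_ge0 => x _; exact: poweR_ge0.
set J := (\int[_]_x (`|(nf x)%:E| `^ p))%E in I1 I0 *.
apply: (@le_trans _ _ ((C%:E * J) `^ p^-1)%E).
  apply: gt0_ler_poweR; rewrite ?invr_ge0 ?(ltW p0)// in_itv/= leey andbT.
    by apply: integral_ge0 => x _; exact: poweR_ge0.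
  by rewrite mule_ge0 ?lee_fin ?(ltW C0).
rewrite poweRM ?lee_fin ?(ltW C0)//; apply: lee_wpmul2r; first exact: poweR_ge0.
rewrite poweR_EFin lee_fin -[leRHS](powRr1 (ltW C0)).
by apply: ler_powR => //; rewrite invf_le1//; lra.
Qed.
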